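(* Let $P$ be any graph property and fix $\varepsilon\in(0,1)$. There is a randomized algorithm which, given oracle access in the adjacency list model to a forest $G$ on $n$ vertices, accepts with probability at least $2/3$ if $G$ satisfies $P$, and rejects with probability at least $2/3$ if $G$ is $\varepsilon$-far from $P$, i.e., at least $\varepsilon n$ edges must be added or removed from $G$ to obtain a graph satisfying $P$. The algorithm makes $\mathrm{polylog}(n)$ queries.
   Context: A graph property is a family of graphs closed under isomorphism. Adjacency list model: the oracle answers degree queries (given $v$, return $\deg_G(v)$) and neighbor queries (given $v$ and $i$, return the $i$-th neighbor of $v$). *)

(* Defs.v *)
From HB Require Import structures.
From mathcomp Require Import all_boot all_order all_algebra.
From mathcomp Require Import reals.

Set Implicit Arguments.
Unset Strict Implicit.
Unset Printing Implicit Defensive.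

Import Order.TTheory GRing.Theory Num.Theory.

Local Open Scope ring_scope.

(* Finite simple graphs on the vertex set {0, ..., n-1}. *)
Record graph (n : nat) := Graph {
  adj :> rel 'I_n;
  adj_sym : symmetric adj;
  adj_irr : irreflexive adj }.

Definition isomorphic (m n : nat) (G : graph m) (H : graph n) : Prop :=
  exists2 f : 'I_m -> 'I_n, bijective f & forall x y, H (f x) (f y) = G x y.

Record graph_property := GraphProperty {
  satisfies :> forall n : nat, graph n -> Prop;
  satisfies_iso : forall (m n : nat) (G : graph m) (H : graph n),
    isomorphic G H -> satisfies G -> satisfies H }.

Definition forest (n : nat) (G : graph n) : Prop :=
  forall c : seq 'I_n, (2 < size c)%N -> ~ ucycle G c.

Definition edges (n : nat) (G : graph n) : {set {set 'I_n}} :=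
  [set [set x; y] | x in 'I_n, y in G x].

Definition edit_distance (n : nat) (G H : graph n) : nat :=
  #|(edges G :\: edges H) :|: (edges H :\: edges G)|.

(* If no graph on n vertices satisfies P, every graph on n vertices is far
   from P. *)
Definition eps_far (R : realType) (eps : R) (P : graph_property)
    (n : nat) (G : graph n) : Prop :=
  forall H : graph n, P n H -> eps * n%:R <= (edit_distance G H)%:R.

(* The neighbors of each vertex are listed in an arbitrary order. *)
Record adj_list (n : nat) (G : graph n) := AdjList {
  nbrs :> 'I_n -> seq 'I_n;
  nbrs_uniq : forall v, uniq (nbrs v);
  mem_nbrs : forall v w, (w \in nbrs v) = G v w }.

(* Randomized adaptive query algorithms (computationally unbounded, with
   true = accept) on inputs with vertex set {0, ..., n-1}.  [Random m k] draws i
   uniformly from {0, ..., m} and continues with k i. *)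
Inductive algorithm (n : nat) : Type :=
  | Output of bool
  | Random (m : nat) of 'I_m.+1 -> algorithm n
  | DegreeQuery of 'I_n & (nat -> algorithm n)
  | NeighborQuery of 'I_n & nat & (option 'I_n -> algorithm n).

(* Neighbors are numbered from 0; a neighbor query with index at least the
   degree is answered by None. *)
Fixpoint output_prob (R : realType) (n : nat) (L : 'I_n -> seq 'I_n)
    (A : algorithm n) (b : bool) : R :=
  match A with
  | Output c => (c == b)%:R
  | Random m k => (\sum_(i < m.+1) output_prob R L (k i) b) / m.+1%:R
  | DegreeQuery v k => output_prob R L (k (size (L v))) b
  | NeighborQuery v i k => output_prob R L (k (onth (L v) i)) b
  end.

(* The maximum, over the random choices, of the number of queries made. *)
Fixpoint query_count (n : nat) (L : 'I_n -> seq 'I_n) (A : algorithm n) : nat :=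
  match A with
  | Output _ => 0%N
  | Random m k => (\max_(i < m.+1) query_count L (k i))%N
  | DegreeQuery v k => (query_count L (k (size (L v)))).+1
  | NeighborQuery v i k => (query_count L (k (onth (L v) i))).+1
  end.

(* The integer part of log_2 n is at least half of log_2 n when n >= 2, so
   rounding only affects the constant C. *)
Definition polylog (q : nat -> nat) : Prop :=
  exists C k : nat,
    forall n : nat, (1 < n)%N -> (q n <= C * trunc_log 2 n ^ k)%N.

(* Main.v *)
(**
  Remove few edges of a forest so that what remains is a set of bounded-size
  pieces, each of which is attached by at most one edge to a hub (a vertex of
  large degree).  Outside the hubs, call an edge core if both of its sides have
  more than [s] vertices.  Core edges form a forest with few leaves, so cutting
  them at the vertices of core degree at least 3 costs little and leaves paths;
  these are cut at random vertices, and at the few places where the random cut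
  would leave a long path.  The rule is local: once the random cut is drawn, the
  piece of a vertex is found with a constant number of queries.

  The resulting graph is determined, up to few edges, by the number of pieces
  with given isomorphism type and given class of the adjacent hub, where the
  class of a hub consists of its rounded degree and the approximate
  distribution of the types of the pieces attached to it.  There are O(log n)
  classes, hence the counts can be estimated from polylog(n) random vertices.
  The tester accepts if the estimated counts are compatible with some forest
  that satisfies the property, for some choice of the random cut and samples.
*)
Require Import Defs.
From HB Require Import structures.
From mathcomp Require Import all_boot all_order all_algebra.
From mathcomp Require Import boolp reals zify.

Set Implicit Arguments.
Unset Strict Implicit.
Unset Printing Implicit Defensive.

Import Order.TTheory GRing.Theory Num.Theory.

(** * Acyclic relations *)

(** Hubs can be too rare to be sampled, so the number of hubs in a class is never estimated. Two
    well-sampled hubs of one class differ, for each type of attached piece, by a small fraction of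
    their degrees, and the degrees in a forest sum to at most twice its order. Hence a surplus of
    hubs of some class in one of two forests shows up as a surplus of pieces with the corresponding
    labels, and the counts of pieces, which random vertices do estimate, are enough. The cut of the
    core paths is random because a local rule must place the cuts without seeing where a path
    begins; each vertex decides on its own, and only the rare long gaps need a correction.
    Probabilities are cardinalities of sets of seeds with all denominators cleared, so that the
    argument stays in the integers almost to the end. Edges are counted as darts, that is ordered
    pairs, twice each. *)

Section AcyclicRelations.
Variables (V : finType) (e : rel V).
Hypothesis e_sym : symmetric e.
Hypothesis e_irr : irreflexive e.
Hypothesis e_acyclic : forall c : seq V, 2 < size c -> ~ ucycle e c.

(** Non-backtracking walks. The conditions are local, so a walk can be prolonged one vertex at a
    time; [nbwalk_uniq] turns it into a simple path. *)
Fixpoint nbwalk (s : seq V) : bool :=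
  if s is x :: t then
    [&& (if t is y :: t' then e x y && (if t' is w :: _ then x != w else true)
         else true) & nbwalk t]
  else true.

Lemma nbwalk_path x p : nbwalk (x :: p) -> path e x p.
Proof.
elim: p x => [//|y p IH] x /= /and3P[/andP[exy _] h1 h2].
by rewrite exy IH //= h1.
Qed.

(** A return to [x] would close a cycle. Closed walks too short for [e_acyclic] are excluded by
    irreflexivity and by the absence of backtracking. *)
Lemma nbwalk_uniq s : nbwalk s -> uniq s.
Proof.
elim: s => [//|x t IH] H.
have walk_t : nbwalk t by move: H => /= /andP[].
rewrite cons_uniq IH // andbT; apply/negP => xt.
have pth := nbwalk_path H.
move: H (IH walk_t) pth; case/splitPr: xt => p1 p2 H Ut pth.
apply: (e_acyclic (c := x :: p1)).
  case: p1 H pth {Ut} => [|y [|z p1]] //=; first by rewrite e_irr.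
  by rewrite eqxx andbF.
apply/andP; split; last first.
  move: Ut; rewrite cat_uniq /= negb_or => /and3P[-> /andP[-> _] _] //.
rewrite /= rcons_path.
by move: pth; rewrite cat_path /= => /and3P[-> ->].
Qed.

(** If every vertex of [A] had two neighbors in [A], non-backtracking walks inside [A] could be
    prolonged for ever, yet they never repeat a vertex. *)
Lemma acyclic_leaf (A : {set V}) : A != set0 ->
  exists2 v, v \in A &
    {in A &, forall x y, e v x -> e v y -> x = y}.
Proof.
move=> /set0Pn[a aA].
have [/exists_inP[v vA /forall_inP h]|] :=
  boolP [exists v in A, [forall x in A, forall y in A, e v x ==> e v y ==> (x == y)]].
  exists v => // x y xA yA evx evy.
  by move: (h x xA) => /forall_inP/(_ y yA); rewrite evx evy => /eqP.
rewrite negb_exists_in => /forall_inP no_leaf.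
have ext v u : v \in A -> exists w, [&& w \in A, e v w & w != u].
  move=> vA; have := no_leaf v vA.
  rewrite negb_forall_in => /exists_inP[x xA].
  rewrite negb_forall_in => /exists_inP[y yA].
  rewrite !negb_imply => /and3P[evx evy xy].
  have [xu|xu] := eqVneq x u; last by exists x; rewrite xA evx.
  by exists y; rewrite yA evy; rewrite eq_sym -xu.
have walks k : exists x t, [&& x \in A, size t == k & nbwalk (x :: t)].
  elim: k => [|k [x [t /and3P[xA /eqP st nb]]]]; first by exists a, [::]; rewrite aA.
  have [w /and3P[wA exw wu]] := ext x (head x t) xA.
  exists w, (x :: t); rewrite wA /= st eqxx /= e_sym exw /=.
  by case: t wu nb {st} => //= y t -> ->.
have [x [t /and3P[_ /eqP st nb]]] := walks #|V|.
have := max_card (mem (x :: t)).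
by rewrite (card_uniqP (nbwalk_uniq nb)) /= st ltnn.
Qed.

(* [f] maps a vertex to its parent, and a root to itself. *)
Definition rooting (f : V -> V) (rk : V -> nat) :=
  (forall x, f x = x \/ e x (f x) /\ rk x < rk (f x)) /\
  (forall x y, e x y -> f x = y \/ f y = x).

(** Leaves are stripped one at a time: a leaf of [A] gets its only neighbor in [A] as parent, and
    rank 0, below the shifted ranks of the others. *)
Lemma acyclic_rooting : exists f rk, rooting f rk.
Proof.
suff H k (A : {set V}) : #|A| = k -> exists (f : V -> V) (rk : V -> nat),
   {in A, forall x, f x = x \/ [/\ f x \in A, e x (f x) & rk x < rk (f x)]} /\
   {in A &, forall x y, e x y -> f x = y \/ f y = x}.
  have [f [rk [h1 h2]]] := H _ [set: V] erefl.
  exists f, rk; split=> [x|x y]; last by apply: h2; rewrite inE.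
  by have [|->|[_ h h']] := h1 x; rewrite ?inE //; [left|right].
elim: k A => [|k IH] A cA.
  exists id, (fun=> 0); move/eqP: cA; rewrite cards_eq0 => /eqP->.
  by split=> x; rewrite ?inE // => y; rewrite inE.
have A0 : A != set0 by rewrite -cards_eq0 cA.
have [v vA leaf] := acyclic_leaf A0.
have [f [rk [h1 h2]]] : exists f rk,
   {in A :\ v, forall x, f x = x \/ [/\ f x \in A :\ v, e x (f x) & rk x < rk (f x)]} /\
   {in A :\ v &, forall x y, e x y -> f x = y \/ f y = x}.
  by apply: IH; move: cA; rewrite (cardsD1 v) vA => -[].
pose fv := if [pick w in A | e v w] is Some w then w else v.
exists (fun x => if x == v then fv else f x),
       (fun x => if x == v then 0 else (rk x).+1).
split=> [x xA|x y xA yA exy].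
  have [->|xv] := eqVneq x v.
    rewrite /fv; case: pickP => [w /andP[wA evw]|_]; last by left.
    right; split=> //; case: eqVneq => // wv; by rewrite wv e_irr in evw.
  have [|->|[fA exf lt]] := h1 x; first by rewrite !inE xv.
    by left.
  right; move: fA; rewrite !inE => /andP[/negPf-> fA]; split => //.
have vw w : w \in A -> e v w -> fv = w.
  move=> wA evw; rewrite /fv; case: pickP => [w' /andP[w'A evw']|/(_ w)].
    exact: leaf.
  by rewrite wA evw.
have [xv|xv] := eqVneq x v.
  by left; apply: vw => //; rewrite -xv.
have [yv|yv] := eqVneq y v.
  by right; apply: vw => //; rewrite e_sym -yv.
by apply: h2; rewrite ?inE ?xv ?yv.
Qed.

End AcyclicRelations.

Lemma leq_sum_mem (T : eqType) (F : T -> nat) (r : seq T) (P : pred T) x :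
  x \in r -> P x -> F x <= \sum_(y <- r | P y) F y.
Proof. by move=> xr Px; rewrite (big_rem x) //= Px leq_addr. Qed.

Lemma sum_card_trivI (I T : finType) (P : pred I) (A : I -> {set T}) (B : {set T}) :
  (forall i, P i -> A i \subset B) ->
  (forall i j x, P i -> P j -> x \in A i -> x \in A j -> i = j) ->
  \sum_(i | P i) #|A i| <= #|B|.
Proof.
move=> sub triv.
under eq_bigr do rewrite -sum1_card big_mkcond.
rewrite exchange_big /= -sum1_card [leqRHS]big_mkcond; apply: leq_sum => x _.
have [i /andP[Pi xi]|none] := pickP [pred i | P i && (x \in A i)].
  rewrite (bigD1 i) //= xi big1 => [|j /andP[Pj ji]].
    by rewrite (subsetP (sub i Pi)).
  by case: ifP => // xj; rewrite (triv j i x) ?eqxx in ji.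
rewrite big1 // => i Pi; have := none i; rewrite /= Pi /= => ->; by [].
Qed.
Arguments leq_sum_mem {T} F {r P x}.

(** * Local decomposition of a forest *)

Section Decomposition.
Variables (d s l : nat) (V : finType) (L : V -> seq V) (z : pred V).

Definition hub v := d < size (L v).

Definition lowN v := if hub v then [::] else [seq u <- take d (L v) | ~~ hub u].

Definition hubN v := if hub v then [::] else [seq u <- take d (L v) | hub u].

(* The size of the component of [v] after removing the edge [uv], in the forest
   of the edges without hub endpoints.  It is only meaningful up to [s]: when
   the fuel [k] runs out, the value [s + 1] stands for "more than [s]". *)
Fixpoint side_size k v u :=
  if k is k'.+1 then (\sum_(w <- lowN v | w != u) side_size k' w v).+1 else s.+1.

Definition big v u := s < side_size s v u.

Definition core v u := [&& u \in lowN v, big v u & big u v].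

Definition coreN v := [seq u <- lowN v | big v u && big u v].

Definition branch v := 2 < size (coreN v).

(* Some non-backtracking walk of [k] more core edges extends the edge [xy] and
   meets neither a random cut vertex (in [z]) nor a branch vertex before its
   last one. *)
Fixpoint long_run k x y :=
  if k is k'.+1 then
    [&& ~~ z y, ~~ branch y & has (fun w => (w != x) && long_run k' y w) (coreN y)]
  else true.

Definition cut x y :=
  [|| z x, z y, branch x, branch y, long_run l x y | long_run l y x].

Definition pieceN x := [seq y <- lowN x | core x y ==> ~~ cut x y].

Fixpoint ball k v : {set V} :=
  if k is k'.+1 then v |: \bigcup_(w <- pieceN v) ball k' w else [set v].

(* Simple paths of [pieceN] have length at most [2 s + l], so this ball is the
   whole component of [v] (lemma [mem_piece]). *)
Definition piece v := ball (s.*2 + l) v.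

Definition hub_edges (A : {set V}) :=
  flatten [seq [seq (x, h) | h <- hubN x] | x <- enum A].

(* A piece stays attached to the hubs only if exactly one edge links it to
   them. *)
Definition attach (A : {set V}) :=
  if hub_edges A is [:: e] then Some e else None.

Definition kept x y :=
  [|| y \in pieceN x,
      ~~ hub x && (attach (piece x) == Some (x, y))
    | ~~ hub y && (attach (piece y) == Some (y, x))].

Definition removed := #|[pred p : V * V | (p.2 \in L p.1) && ~~ kept p.1 p.2]|.

Hypothesis L_uniq : forall v, uniq (L v).
Hypothesis L_sym : forall v w, (w \in L v) = (v \in L w).
Hypothesis L_irr : forall v, v \notin L v.
Hypothesis L_acyclic : forall c : seq V, 2 < size c -> ~ ucycle (fun x y => y \in L x) c.

Lemma mem_lowN v u : (u \in lowN v) = [&& ~~ hub v, ~~ hub u & u \in L v].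
Proof.
rewrite /lowN; case: ifP => //= hv; rewrite mem_filter take_oversize //.
by rewrite leqNgt; apply/negbT.
Qed.

Lemma mem_hubN v u : (u \in hubN v) = [&& ~~ hub v, hub u & u \in L v].
Proof.
rewrite /hubN; case: ifP => //= hv; rewrite mem_filter take_oversize //.
by rewrite leqNgt; apply/negbT.
Qed.

Lemma lowN_uniq v : uniq (lowN v).
Proof. by rewrite /lowN; case: ifP => // _; rewrite filter_uniq // take_uniq. Qed.

Lemma hubN_uniq v : uniq (hubN v).
Proof. by rewrite /hubN; case: ifP => // _; rewrite filter_uniq // take_uniq. Qed.

Lemma size_lowN v : size (lowN v) <= d.
Proof.
rewrite /lowN; case: ifP => // _; rewrite size_filter.
by rewrite (leq_trans (count_size _ _)) // size_take_min geq_minl.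
Qed.

Lemma size_pieceN v : size (pieceN v) <= d.
Proof. by rewrite size_filter (leq_trans (count_size _ _)) ?size_lowN. Qed.

Lemma lowN_sym v u : (u \in lowN v) = (v \in lowN u).
Proof. by rewrite !mem_lowN L_sym; do 2![case: hub]. Qed.

Lemma lowN_irr v : v \notin lowN v.
Proof. by rewrite mem_lowN (negPf (L_irr v)) !andbF. Qed.

Lemma sub_lowN v u : u \in lowN v -> u \in L v.
Proof. by rewrite mem_lowN => /and3P[]. Qed.

Lemma sub_ucycle (e e' : rel V) c : (forall x y, e x y -> e' x y) ->
  ucycle e c -> ucycle e' c.
Proof.
move=> sub /andP[cyc U]; apply/andP; split=> //.
by case: c cyc {U} => //= x c; apply: sub_path.
Qed.

Lemma lowN_acyclic (c : seq V) : 2 < size c -> ~ ucycle (fun x y => y \in lowN x) c.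
Proof.
move=> sc cyc; apply: (L_acyclic sc).
by apply: sub_ucycle cyc => x y; apply: sub_lowN.
Qed.

Lemma mem_coreN v u : (u \in coreN v) = core v u.
Proof. by rewrite mem_filter /core andbC. Qed.

Lemma core_sym v u : core v u = core u v.
Proof. by rewrite /core lowN_sym [big v u && _]andbC. Qed.

Lemma cut_sym x y : cut x y = cut y x.
Proof.
rewrite /cut; do 2![case: (z _) => //=]; do 2![case: (branch _) => //=].
by rewrite orbC.
Qed.

Lemma mem_pieceN x y : (y \in pieceN x) = (y \in lowN x) && (core x y ==> ~~ cut x y).
Proof. by rewrite mem_filter andbC. Qed.

Lemma pieceN_sym x y : (y \in pieceN x) = (x \in pieceN y).
Proof. by rewrite !mem_pieceN lowN_sym core_sym cut_sym. Qed.

Lemma side_sizeS k v u :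
  side_size k.+1 v u = (\sum_(w <- lowN v | w != u) side_size k w v).+1.
Proof. by []. Qed.

(** An exhausted branch alone contributes [s + 1], so a value at most [s] means that the fuel never
    ran out. *)
Lemma side_size_step k v u : side_size k v u <= s -> side_size k.+1 v u = side_size k v u.
Proof.
elim: k v u => [|k IH] v u; first by rewrite /= ltnn.
move=> H; rewrite side_sizeS [RHS]side_sizeS; congr S; rewrite side_sizeS in H.
rewrite [LHS]big_seq_cond [RHS]big_seq_cond.
apply: eq_bigr => w /andP[wN wu]; apply: IH.
apply: leq_trans (ltnW H); exact: (leq_sum_mem (fun w => side_size k w v)).
Qed.

(** The side of [v] away from [w] contains the side of [u] away from [v]. The two evaluations differ
    in fuel by one, which [side_size_step] repairs. *)
Lemma big_mono u v w : u \in lowN v -> u != w -> big u v -> big v w.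
Proof.
move=> uN uw bu; rewrite /big ltnNge; apply/negP => H.
have [s0|s_gt0] := posnP s; first by move: H; rewrite {1}s0 [in leqRHS]s0.
have sP x y : side_size s x y = side_size s.-1.+1 x y by rewrite prednK.
move: H; rewrite sP side_sizeS => H.
have le : side_size s.-1 u v < s.
  apply: leq_trans H; exact: (leq_sum_mem (fun w => side_size s.-1 w v)).
by move: bu; rewrite /big sP (side_size_step (ltnW le)) ltnNge (ltnW le).
Qed.

(* Along a non-backtracking walk the side of the [i]-th edge has more than [i]
   vertices. *)
Lemma side_size_walk (v : nat -> V) r :
  (forall i, i < r -> v i.+1 \in lowN (v i)) ->
  (forall i, i.+1 < r -> v i != v i.+2) ->
  forall i, s <= i < r -> big (v i) (v i.+1).
Proof.
move=> adj nb.
have lower k i : i <= s -> i < r -> i < side_size k (v i) (v i.+1).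
  elim: i k => [|i IH] [|k] /= is_ ir; rewrite ?ltnS //.
  apply: leq_trans (IH k (ltnW is_) (ltnW ir)) _.
  apply: (leq_sum_mem (fun w => side_size k w (v i.+1))); last exact: nb.
  by rewrite lowN_sym adj // ltnW.
(* Counting works up to index [s] only, because of the cap in [side_size]; beyond it, [big_mono]
   takes over. *)
elim=> [|i IH] /andP[si ir].
  by rewrite /big (leq_ltn_trans si) // lower.
have [is_|lt] := leqP i.+1 s.
  by rewrite /big (leq_ltn_trans si) // lower.
apply: (@big_mono (v i)).
- by rewrite lowN_sym adj // ltnW.
- exact: nb.
- by apply: IH; rewrite -ltnS lt ltnW.
Qed.

Notation pieceR := (fun x y => y \in pieceN x).

Lemma core_run_long (v : nat -> V) r k i :
  (forall j, s <= j < r -> core (v j) (v j.+1) /\ ~~ cut (v j) (v j.+1)) ->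
  (forall j, j.+1 < r -> v j != v j.+2) ->
  s <= i -> i + k < r -> long_run k (v i) (v i.+1).
Proof.
move=> run nb; elim: k i => [//|k IH] i si ik.
have ir : i < r by apply: leq_trans ik; rewrite ltnS leq_addr.
have [_] : core (v i) (v i.+1) /\ ~~ cut (v i) (v i.+1) by apply: run; rewrite si ir.
rewrite /cut !negb_or /= => /and5P[_ -> _ -> _] /=.
apply/hasP; exists (v i.+2).
  by rewrite mem_coreN; apply: (proj1 (run i.+1 _)); lia.
rewrite eq_sym nb /=; last lia.
by apply: IH; lia.
Qed.

(* All edges of a path but the first and last [s] are core edges, and more than
   [l] consecutive core edges make a long run, which is cut. *)
Lemma piece_path_size x p : path pieceR x p -> uniq (x :: p) -> size p <= s.*2 + l.
Proof.
move=> /(pathP x) pth U; rewrite leqNgt; apply/negP => big_p.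
set r := size p in pth big_p; pose v i := nth x (x :: p) i.
have adj i : i < r -> v i.+1 \in pieceN (v i) by move=> ir; apply: pth.
have low i : i < r -> v i.+1 \in lowN (v i).
  by move=> /adj; rewrite mem_pieceN => /andP[].
have nb i : i.+1 < r -> v i != v i.+2 by move=> ir; rewrite nth_uniq //=; rewrite -/r; lia.
have core_i j : s <= j < r - s -> core (v j) (v j.+1) /\ ~~ cut (v j) (v j.+1).
  move=> /andP[sj jr]; have jr' : j < r by lia.
  have cj : core (v j) (v j.+1).
    rewrite /core low //= (side_size_walk low nb) ?sj //=.
    (* The other side of the edge is big by the same lemma, applied to the path read backwards. *)
    have := @side_size_walk (fun i => v (r - i)) r _ _ (r - j.+1).
    have -> : r - (r - j.+1) = j.+1 by lia.
    have -> : r - (r - j.+1).+1 = j by lia.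
    apply; last by lia.
    - move=> i ir; rewrite lowN_sym; have -> : r - i = (r - i.+1).+1 by lia.
      by apply: low; lia.
    - move=> i ir; rewrite eq_sym; have -> : r - i = (r - i.+2).+2 by lia.
      by apply: nb; lia.
  split=> //; have := adj j jr'; by rewrite mem_pieceN cj => /andP[].
(* More than [l] edges lie between positions [s] and [r - s], so a long run starts at the first of
   them, which should therefore have been cut. *)
have lng : long_run l (v s) (v s.+1).
  apply: (core_run_long core_i) => // [j jr|]; last by lia.
  by apply: nb; lia.
have [|_] := core_i s; first by lia.
by rewrite /cut lng !orbT.
Qed.

Lemma mem_ball k v w : reflect (exists p, [/\ path pieceR v p, size p <= k & last v p = w])
  (w \in ball k v).
Proof.
apply: (iffP idP).
  elim: k v => [|k IH] v /=.
    by rewrite inE => /eqP->; exists [::].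
  rewrite in_setU1 => /orP[/eqP->|]; first by exists [::].
  rewrite bigcup_seq => /bigcupP[u uN /IH[p [pth sp lp]]].
  by exists (u :: p); rewrite /= uN.
case=> p []; elim: k v p => [|k IH] v [|u p] //=; rewrite ?inE.
- by move=> _ _ ->.
- by move=> _ _ ->; rewrite eqxx.
move=> /andP[uN pth] sp lp; apply/orP; right.
by rewrite bigcup_seq; apply/bigcupP; exists u => //; apply: IH pth sp lp.
Qed.

Lemma mem_piece v w : (w \in piece v) = connect pieceR v w.
Proof.
apply/mem_ball/connectP => [[p [pth _ lp]]|[p pth ->]]; first by exists p.
case/shortenP: pth => p' pth U _; exists p'; split=> //.
exact: piece_path_size pth U.
Qed.

Lemma pieceR_sym : connect_sym pieceR.
Proof. by apply: sym_connect_sym => x y; apply: pieceN_sym. Qed.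

Lemma piece_refl v : v \in piece v.
Proof. by rewrite mem_piece connect0. Qed.

Lemma piece_eq x y : y \in piece x -> piece y = piece x.
Proof.
rewrite mem_piece => xy; apply/setP => w; rewrite !mem_piece.
by rewrite (same_connect pieceR_sym xy).
Qed.

Lemma piece_sym x y : y \in piece x -> x \in piece y.
Proof. by move=> /piece_eq ->; apply: piece_refl. Qed.

(** A hub is isolated in [pieceN], so its piece is a singleton. *)
Lemma piece_hub x y : y \in piece x -> hub y = hub x.
Proof.
rewrite mem_piece => /connectP[p pth ->]; elim: p x pth => //= y' p IH x.
move=> /andP[yN /IH->]; move: yN.
by rewrite mem_pieceN mem_lowN => /andP[/and3P[/negPf-> /negPf->]].
Qed.

Lemma card_ball k v : #|ball k v| <= d.+1 ^ k.
Proof.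
elim: k v => [|k IH] v /=; first by rewrite cards1.
apply: leq_trans (leq_card_setU _ _) _; rewrite cards1.
have : #|\bigcup_(w <- pieceN v) ball k w| <= \sum_(w <- pieceN v) d.+1 ^ k.
  elim: (pieceN v) => [|w r IHr]; first by rewrite !big_nil cards0.
  rewrite !big_cons; apply: leq_trans (leq_card_setU _ _) _; exact: leq_add.
rewrite big_const_seq count_predT iter_addn_0 => H.
have {}H := leq_trans H (leq_mul (leqnn _) (size_pieceN v)).
rewrite expnS mulSn [d * _]mulnC leq_add ?expn_gt0 //.
Qed.

Lemma card_piece v : #|piece v| <= d.+1 ^ (s.*2 + l).
Proof. exact: card_ball. Qed.

Lemma mem_hub_edges (A : {set V}) x h : ((x, h) \in hub_edges A) = (x \in A) && (h \in hubN x).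
Proof.
apply/flatten_mapP/andP => [[y yA /mapP[h' hN [-> ->]]]|[xA hN]].
  by rewrite mem_enum in yA.
by exists x; rewrite ?mem_enum //; apply/mapP; exists h.
Qed.

Lemma hub_edges_uniq (A : {set V}) : uniq (hub_edges A).
Proof.
apply: (@allpairs_uniq_dep _ (fun _ => V)).
- exact: enum_uniq.
- by move=> x _; apply: hubN_uniq.
- by move=> [x h] [x' h'] _ _ /= [-> ->].
Qed.

Lemma attachP (A : {set V}) x h : attach A = Some (x, h) ->
  [/\ x \in A, ~~ hub x, hub h & h \in L x].
Proof.
rewrite /attach; case E: (hub_edges A) => [|e [|]] // [eE].
have : (x, h) \in hub_edges A by rewrite E eE mem_head.
by rewrite mem_hub_edges mem_hubN => /andP[-> /and3P[-> -> ->]].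
Qed.

(** The second hub edge obtained here receives the charge in [card_unattached]. *)
Lemma not_attach (A : {set V}) x h : x \in A -> ~~ hub x -> hub h -> h \in L x ->
  attach A != Some (x, h) -> exists x' h', [/\ x' \in A, ~~ hub x', hub h', h' \in L x' & (x', h') != (x, h)].
Proof.
move=> xA hx hh hL; have xh : (x, h) \in hub_edges A.
  by rewrite mem_hub_edges xA mem_hubN hx hh hL.
have U := hub_edges_uniq A; rewrite /attach.
have key e : e \in hub_edges A -> e != (x, h) ->
    exists x' h', [/\ x' \in A, ~~ hub x', hub h', h' \in L x' & (x', h') != (x, h)].
  case: e => x' h'; rewrite mem_hub_edges mem_hubN => /andP[xA' /and3P[h1 h2 h3]] ne.
  by exists x', h'.
case E: (hub_edges A) xh U key => [|e [|e' r]] //=.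
  by rewrite inE => /eqP->; rewrite eqxx.
move=> xh /andP[ee' _] key _.
have [ne|ne] := eqVneq e (x, h); last by apply: (key e); rewrite ?mem_head.
by apply: (key e'); rewrite ?inE ?eqxx ?orbT // -ne eq_sym; move: ee'; rewrite inE negb_or => /andP[].
Qed.

End Decomposition.
Arguments piece_refl {d s l V L z}.
Arguments card_piece {d s l V L z}.

(** * The number of removed edges *)

Lemma card_darts (V : finType) (P : pred V) (F : V -> seq V) :
  (forall x, uniq (F x)) ->
  #|[pred p : V * V | P p.1 && (p.2 \in F p.1)]| = \sum_(x | P x) size (F x).
Proof.
move=> U; rewrite -sum1_card (eq_bigr (fun x => \sum_(y | y \in F x) 1)).
  by rewrite pair_big_dep.
by move=> x _; rewrite sum1_card (card_uniqP (U x)).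
Qed.

Lemma card_swap (V : finType) (P : V -> V -> bool) :
  #|[pred p : V * V | P p.2 p.1]| = #|[pred p : V * V | P p.1 p.2]|.
Proof.
have inj : injective (fun p : V * V => (p.2, p.1)) by move=> [? ?] [? ?] [-> ->].
by rewrite -(on_card_preimset (onW_bij _ (injF_bij inj))) cardsE; apply: eq_card => -[x y].
Qed.

Lemma card_predU_le (T : finType) (A B C : pred T) :
  (forall x, A x -> B x || C x) -> #|A| <= #|B| + #|C|.
Proof.
move=> sub; apply: leq_trans (_ : #|[predU B & C]| <= _).
  by apply: subset_leq_card; apply/subsetP => x /sub.
by rewrite -cardUI leq_addr.
Qed.

(** * Rooted forests and their darts *)

Section Rooting.
Variables (V : finType) (e : rel V) (f : V -> V) (rk : V -> nat).
Hypothesis root_f : rooting e f rk.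

Lemma rank_lt x : f x != x -> rk x < rk (f x).
Proof. by have [h _] := root_f; have [->|[]] := h x; rewrite ?eqxx. Qed.

Lemma rank_connect x y : fconnect f x y -> x = y \/ rk x < rk y.
Proof.
case/connectP => p; elim: p x => [|a p IH] x /=; first by move=> _ ->; left.
case/andP => /eqP <- pth ly; have [E|/rank_lt lt] := eqVneq (f x) x.
  by rewrite E in pth ly; apply: IH.
by right; case: (IH _ pth ly) => [<- //|]; apply: ltn_trans.
Qed.

Lemma rank_parent x : f (f x) = x -> f x = x.
Proof.
move=> ffx; apply/eqP; case: (eqVneq (f x) x) => // ne.
have l1 := rank_lt ne.
have l2 : rk (f x) < rk (f (f x)) by apply: rank_lt; rewrite ffx eq_sym.
by move: (ltn_trans l1 l2); rewrite ffx ltnn.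
Qed.

Lemma fconnect_total w x y : fconnect f w x -> fconnect f w y ->
  fconnect f x y \/ fconnect f y x.
Proof.
move=> /iter_findex <- /iter_findex <-.
have [le|/ltnW le] := leqP (findex f w x) (findex f w y); [left|right];
  rewrite -(subnK le) iterD; exact: fconnect_iter.
Qed.

(** Each dart joins a vertex to its parent, upwards or downwards; the child and the direction
    determine it. *)
Lemma card_darts_rooting (P : pred (V * V)) :
  (forall x y, P (x, y) -> e x y) ->
  #|P| <= #|[pred x | P (x, f x)]| + #|[pred y | P (f y, y)]|.
Proof.
move=> sub; pose A := [set (x, f x) | x in [pred x | P (x, f x)]].
pose B := [set (f y, y) | y in [pred y | P (f y, y)]].
apply: leq_trans (leq_add (leq_imset_card _ _) (leq_imset_card _ _)).
apply: leq_trans (leq_card_setU A B); apply: subset_leq_card; apply/subsetP => -[x y] Pxy.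
have [_ h] := root_f; rewrite inE; case: (h _ _ (sub _ _ Pxy)) => E; apply/orP.
  by left; apply/imsetP; exists x; rewrite ?inE ?E.
by right; apply/imsetP; exists y; rewrite ?inE ?E.
Qed.

Lemma card_darts_le : #|[pred p : V * V | e p.1 p.2]| <= #|V|.*2.
Proof.
rewrite -addnn; apply: leq_trans (card_darts_rooting _) _ => //.
by apply: leq_add; apply: max_card.
Qed.

End Rooting.

Section Counting.
Variables (d s l : nat) (V : finType) (L : V -> seq V) (z : pred V).
Hypothesis L_uniq : forall v, uniq (L v).
Hypothesis L_sym : forall v w, (w \in L v) = (v \in L w).
Hypothesis L_irr : forall v, v \notin L v.
Hypothesis L_acyclic : forall c : seq V, 2 < size c -> ~ ucycle (fun x y => y \in L x) c.

Notation hub := (hub d L).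
Notation lowN := (lowN d L).
Notation side_size := (side_size d s L).
Notation big := (big d s L).
Notation core := (core d s L).
Notation coreN := (coreN d s L).
Notation branch := (branch d s L).
Notation long_run := (long_run d s L z).
Notation cut := (cut d s l L z).
Notation pieceN := (pieceN d s l L z).
Notation piece := (piece d s l L z).
Notation attach := (attach d L).

Lemma L_rooting : exists f rk, rooting (fun x y => y \in L x) f rk.
Proof.
apply: acyclic_rooting.
- by move=> x y; apply: L_sym.
- by move=> x; apply/negbTE.
- exact: L_acyclic.
Qed.

Lemma lowN_rooting : exists f rk, rooting (fun x y => y \in lowN x) f rk.
Proof.
apply: acyclic_rooting.
- by move=> x y; apply: lowN_sym.
- by move=> x; apply/negbTE/lowN_irr.
- exact: lowN_acyclic.
Qed.

Lemma sum_degree : \sum_v size (L v) <= #|V|.*2.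
Proof.
have [f [rk rt]] := L_rooting; have := card_darts_le rt.
by rewrite -(card_darts predT) //.
Qed.

Lemma card_hubs : d.+1 * #|hub| <= #|V|.*2.
Proof.
apply: leq_trans sum_degree; rewrite mulnC -sum_nat_const big_mkcond.
by apply: leq_sum => v _; case: ifP.
Qed.

(** * Core edges in a rooted forest *)

Section CoreCounting.
Variables (f : V -> V) (rk : V -> nat).
Hypothesis root_f : rooting (fun x y => y \in lowN x) f rk.

Let desc v := [set w | fconnect f w v].

Lemma parent_lowN x : f x != x -> f x \in lowN x.
Proof. by have [h _] := root_f; case: (h x) => [->|[]]; rewrite ?eqxx. Qed.

(** The subtrees of the children are disjoint and miss [v] itself. *)
Lemma sum_desc v :
  (\sum_(w <- lowN v | w != f v) #|desc w|).+1 <= #|desc v|.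
Proof.
have vD : v \in desc v by rewrite inE connect0.
rewrite (cardsD1 v) vD add1n ltnS -big_filter big_uniq ?filter_uniq ?lowN_uniq //=.
have ch w : w \in [seq i <- lowN v | i != f v] -> f w = v /\ f w != w.
  rewrite mem_filter => /andP[wf wN]; have [_ h] := root_f.
  have [E|E] := h _ _ wN; first by rewrite E eqxx in wf.
  split=> //; rewrite E; apply: contraL wN => /eqP <-; exact: lowN_irr.
apply: sum_card_trivI => [w /ch[fw ne]|w w' x /ch[fw ne] /ch[fw' ne']].
  apply/subsetP => x; rewrite !inE => xw.
  have xv : fconnect f x v by rewrite -fw; apply: connect_trans xw (fconnect1 _ _).
  rewrite xv andbT; apply: contra_neq ne => xv'; have [E|lt] := rank_connect root_f xw.
    by rewrite fw -E.
  have [E|lt'] := rank_connect root_f (fconnect1 f w); first by [].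
  by move: (ltn_trans lt lt'); rewrite fw xv' ltnn.
rewrite !inE => xw xw'.
have key a b : f a = v -> f b = v -> f b != b -> fconnect f a b -> a = b.
  move=> fa fb nb ab; case/connectP: ab => [[|c p] /=]; first by move=> _ ->.
  rewrite fa => /andP[/eqP<- pth] lb.
  have vb : fconnect f v b by apply/connectP; exists p.
  have lt := rank_lt root_f nb; rewrite fb in lt.
  by case: (rank_connect root_f vb) => [E|lt']; [rewrite E ltnn in lt | move: (ltn_trans lt lt'); rewrite ltnn].
by case: (fconnect_total xw xw') => h; [|symmetry]; apply: key h.
Qed.

(** Away from the parent the recursion stays in the subtree of [v], whose height is less than its
    size, so the fuel does not run out. *)
Lemma side_size_desc m v : #|desc v| <= m -> side_size m v (f v) <= #|desc v|.
Proof.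
elim: m v => [|m IH] v.
  by rewrite leqn0 cards_eq0 => /eqP/setP/(_ v); rewrite !inE connect0.
move=> le /=; apply: leq_trans (sum_desc v); rewrite ltnS [leqLHS]big_seq_cond [leqRHS]big_seq_cond.
apply: leq_sum => w /andP[wN wf].
have fw : f w = v.
  by have [_ h] := root_f; case: (h _ _ wN) => // E; rewrite E eqxx in wf.
rewrite -fw; apply: IH; rewrite -ltnS; apply: leq_trans le.
apply: leq_trans (sum_desc v); rewrite ltnS.
exact: (leq_sum_mem (fun w => #|desc w|)).
Qed.

(** A core edge is identified with its lower end. *)
Let heavy v := (f v != v) && core v (f v).
Let heavy_children v := #|[pred c | (f c == v) && heavy c]|.
Let heavy_leaf v := heavy v && (heavy_children v == 0).

(** On the way up from [v] the side below the current edge only grows, so it is still big at the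
    last edge before [w]. *)
Lemma big_chain k v w : f v != v -> big v (f v) -> iter k f v = w -> w != v ->
  exists c, [/\ f c = w, c != w & big c w].
Proof.
elim: k v => [|k IH] v; first by move=> _ _ /= ->; rewrite eqxx.
rewrite iterSr => ne bv it _; have [E|wf] := eqVneq w (f v).
  by exists v; rewrite E eq_sym.
have ne' : f (f v) != f v.
  apply: contra_neq wf => E; rewrite -it; elim: (k) => //= j ->; exact: E.
apply: (IH (f v)) => //; apply: (big_mono (u := v)) => //.
  by rewrite lowN_sym // parent_lowN.
by apply: contra_neq ne => E; apply: (rank_parent root_f).
Qed.

(** If [v] lay strictly below [w], the last vertex [c] before [w] on the way up would be a heavy
    child of [w]: its lower side is big by [big_chain], its upper side because it contains the big
    side above [w]. *)
Lemma heavy_leaf_unique v w : heavy_leaf v -> heavy_leaf w -> fconnect f v w -> v = w.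
Proof.
move=> /andP[/andP[nv /and3P[_ bv _]] _] /andP[/andP[nw /and3P[_ _ bw]] lw].
move/iter_findex => it; apply/eqP; rewrite eq_sym; apply: contraLR lw => wv.
have [c [fc cw bc]] := big_chain nv bv it wv.
rewrite -lt0n; apply/card_gt0P; exists c; rewrite inE /heavy fc eqxx eq_sym cw /=.
have wN : w \in lowN c by rewrite -fc parent_lowN // fc eq_sym.
rewrite /core wN bc /=; apply: big_mono bw => //.
- exact: parent_lowN.
- by apply: contra_neq nw => E; apply: (rank_parent root_f); rewrite E.
Qed.

(** By [heavy_leaf_unique] the subtrees of heavy leaves are disjoint, and each has more than [s]
    vertices because it is a big side. *)
Lemma card_heavy_leaf : s.+1 * #|heavy_leaf| <= #|V|.
Proof.
rewrite mulnC -sum_nat_const -[leqRHS]cardsT.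
apply: leq_trans (_ : \sum_(v | heavy_leaf v) #|desc v| <= _).
  apply: leq_sum => v /andP[/andP[_ /and3P[_ bv _]] _]; rewrite ltnNge; apply/negP => le.
  by have := leq_trans (side_size_desc le) le; rewrite leqNgt => /negP; apply.
apply: sum_card_trivI => [v _|v w x hv hw]; first exact: subsetT.
rewrite !inE => xv xw; case: (fconnect_total xv xw) => h.
  exact: heavy_leaf_unique h.
by symmetry; apply: heavy_leaf_unique h.
Qed.

Lemma size_coreN v : size (coreN v) <= (heavy_children v).+1.
Proof.
rewrite -(card_uniqP (filter_uniq _ (lowN_uniq d L_uniq v))).
apply: leq_trans (_ : #|[predU1 (f v) & [pred c | (f c == v) && heavy c]]| <= _).
  apply: subset_leq_card; apply/subsetP => w; rewrite [w \in _]mem_coreN => vw.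
  have [_ h] := root_f; have wN : w \in lowN v by case/and3P: vw.
  case: (h _ _ wN) => E; rewrite !inE -E ?eqxx //; apply/orP; right.
  rewrite ?eqxx /heavy E core_sym // vw andbT.
  by apply: contraL wN => /eqP <-; apply: lowN_irr.
by rewrite cardU1 -[leqRHS]add1n leq_add2r leq_b1.
Qed.

(* A tree with few leaves has few branchings: every heavy vertex is a heavy leaf
   or has a heavy child. *)
Lemma sum_heavy_children : \sum_v (heavy_children v).-1 <= #|heavy_leaf|.
Proof.
have S1 : \sum_v heavy_children v = #|heavy|.
  under eq_bigr do rewrite /heavy_children -sum1_card big_mkcond.
  rewrite exchange_big /= -sum1_card [RHS]big_mkcond; apply: eq_bigr => c _.
  rewrite (bigD1 (f c)) //= big1 => [|v ne]; first by rewrite inE /= eqxx addn0.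
  by rewrite inE /= eq_sym (negPf ne).
have S2 : \sum_v heavy_children v = \sum_v (heavy_children v).-1 + #|[pred v | 0 < heavy_children v]|.
  rewrite -[X in _ + X]sum1_card [X in _ + X]big_mkcond -big_split; apply: eq_bigr => v _ /=.
  by rewrite inE /=; case: (heavy_children v) => [|k]; rewrite ?addn1.
rewrite -(leq_add2r #|[pred v | 0 < heavy_children v]|) -S2 S1.
apply: card_predU_le => v hv; rewrite /heavy_leaf hv /=.
by case: (heavy_children v).
Qed.

End CoreCounting.

Lemma sum_branch : s.+1 * \sum_(v | branch v) size (coreN v) <= 3 * #|V|.
Proof.
have [f [rk rt]] := lowN_rooting.
have H := leq_trans (leq_mul (leqnn s.+1) (sum_heavy_children f)) (card_heavy_leaf rt).
apply: leq_trans (leq_mul (leqnn 3) H); rewrite mulnCA leq_mul2l /=.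
rewrite big_distrr /= big_mkcond; apply: leq_sum => v _; case: ifP => // bv.
(* With [b] heavy children, a branch vertex has core degree [a >= 3] and [a <= b + 1], hence
   [a <= 3 * (b - 1)]. *)
move: bv (size_coreN rt v); rewrite /branch; move: (size _) => a; move: #|_| => b; lia.
Qed.

Lemma card_hub_hub : #|[pred p : V * V | [&& hub p.1, hub p.2 & p.2 \in L p.1]]| <= #|hub|.*2.
Proof.
have [f [rk rt]] := L_rooting; rewrite -addnn.
apply: leq_trans (card_darts_rooting rt _) _ => [x y /and3P[] //|].
apply: leq_add; apply: subset_leq_card; apply/subsetP => x; rewrite !inE => /and3P[] //.
Qed.

(** When [f a] is a hub, no walk inside the piece of [a] climbs above [a], so the whole piece lies
    below [a]. Two such vertices lie below each other. *)
Lemma piece_top f rk x y : rooting (fun x y => y \in L x) f rk ->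
  y \in piece x -> hub (f x) -> hub (f y) -> x = y.
Proof.
move=> rt yx hx hy.
suff key a b : b \in piece a -> hub (f a) -> fconnect f b a.
  have xy : x \in piece y by apply: piece_sym.
  case: (rank_connect rt (key _ _ yx hx)) => // lt.
  case: (rank_connect rt (key _ _ xy hy)) => // lt'.
  by move: (ltn_trans lt lt'); rewrite ltnn.
rewrite mem_piece // => /connectP[p pth ->] ha.
suff gen q y0 : fconnect f y0 a -> path (fun x y => y \in pieceN x) y0 q ->
    fconnect f (last y0 q) a by apply: gen pth; rewrite connect0.
elim: q y0 => //= c q IH y0 y0a /andP[cN pthq]; apply: IH pthq.
move: cN; rewrite mem_pieceN mem_lowN // => /andP[/and3P[_ hc cL] _].
have [_ h] := rt; case: (h _ _ cL) => E; last first.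
  by apply: connect_trans y0a; rewrite -E fconnect1.
case/connectP: y0a => [[|b' q'] /=]; first by move=> _ E'; rewrite E' E in ha; rewrite ha in hc.
by move=> /andP[/eqP <- pq] la; rewrite -E; apply/connectP; exists q'.
Qed.

(* A removed edge from a piece up to a hub is charged to a hub hanging below the
   same piece. *)
Lemma card_unattached : #|[pred p : V * V |
   [&& ~~ hub p.1, hub p.2, p.2 \in L p.1 & attach (piece p.1) != Some p]]| <= #|hub|.*2.
Proof.
have [f [rk rt]] := L_rooting; rewrite -addnn.
apply: leq_trans (card_darts_rooting rt _) _ => [x y /and4P[] //|].
apply: leq_add; last first.
  by apply: subset_leq_card; apply/subsetP => x; rewrite !inE => /and4P[].
set A := [pred x | _]; pose g x := odflt x [pick h | hub h && (f h \in piece x)].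
have gP x : x \in A -> hub (g x) /\ f (g x) \in piece x.
  rewrite !inE /= => /and4P[hx hf fL na].
  rewrite /g; case: pickP => [h /andP[] //|no].
  (* By [piece_top] only one hub edge of the piece leads up, so the second one leads down to a
     hub. *)
  have [x' [h' [xA hx' hh' hL' ne]]] := not_attach L_uniq (piece_refl L_sym x) hx hf fL na.
  have [_ h] := rt; case: (h _ _ hL') => E.
    have := piece_top rt xA hf; rewrite E => /(_ hh') xx'.
    by rewrite -E xx' eqxx in ne.
  by have := no h'; rewrite hh' E xA.
rewrite -(card_in_imset (f := g)) => [|x y xA yA E].
  by apply: subset_leq_card; apply/subsetP => _ /imsetP[x xA ->]; case: (gP x xA).
(* The parent of the chosen hub determines the piece, and [piece_top] then determines the vertex. *)
have [_ px] := gP x xA; have [_ py] := gP y yA; rewrite -E in py.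
have yx : y \in piece x by rewrite -(piece_eq L_sym px) (piece_eq L_sym py) piece_refl.
move: xA yA; rewrite !inE /= => /and4P[_ hx _ _] /and4P[_ hy _ _].
exact: piece_top rt yx hx hy.
Qed.

(** Up to reversal, a cut core dart starts at a branch vertex, starts at a random cut vertex that is
    no branch, or has a long run. A vertex that is no branch has at most two core edges, whence the
    factor 4. *)
Lemma card_cut : #|[pred p : V * V | core p.1 p.2 && cut p.1 p.2]| <=
  2 * \sum_(v | branch v) size (coreN v) + 4 * #|z|
  + 2 * #|[pred p : V * V | core p.1 p.2 && long_run l p.1 p.2]|.
Proof.
pose B := [pred p : V * V | branch p.1 && (p.2 \in coreN p.1)].
pose Z := [pred p : V * V | (z p.1 && ~~ branch p.1) && (p.2 \in coreN p.1)].
pose R := [pred p : V * V | core p.1 p.2 && long_run l p.1 p.2].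
pose half := [predU B & [predU Z & R]].
have cB : #|B| = \sum_(v | branch v) size (coreN v).
  by apply: card_darts => v; rewrite filter_uniq ?lowN_uniq.
have cZ : #|Z| <= 2 * #|z|.
  rewrite (card_darts (fun v => z v && ~~ branch v)) => [|v]; last first.
    by rewrite filter_uniq ?lowN_uniq.
  rewrite mulnC -sum_nat_const big_mkcond [leqRHS]big_mkcond; apply: leq_sum => v _.
  by rewrite -topredE /=; case: (z v) => //=; rewrite /branch -leqNgt; case: ifP.
have cH : #|half| <= #|B| + (#|Z| + #|R|).
  apply: leq_trans (card_predU_le (B := B) (C := [predU Z & R]) _) _ => // .
  by rewrite leq_add2l; apply: card_predU_le.
have : #|[pred p : V * V | core p.1 p.2 && cut p.1 p.2]| <=
   #|[pred p : V * V | half (p.1, p.2)]| + #|[pred p : V * V | half (p.2, p.1)]|.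
  apply: card_predU_le => -[x y] /= /andP[c]; rewrite /cut /half /= !inE /=.
  rewrite !mem_coreN // [core y x]core_sym // c /= !andbT.
  by case: (branch x) => //; case: (branch y); rewrite ?orbT //; case: (z x) => //; case: (z y);
    rewrite ?orbT // => /= /orP[]->; rewrite ?orbT.
rewrite (card_swap (fun x y => half (x, y))).
have -> : #|[pred p : V * V | half (p.1, p.2)]| = #|half| by apply: eq_card => -[].
by rewrite -cB -/R; lia.
Qed.

(** A removed dart joins two hubs, joins a piece to a hub without being its attachment (in either
    direction), or is a cut core dart. The first three kinds cost [2 * #|hub|] each. *)
Lemma removed_le : removed d s l L z <=
  6 * #|hub| + 2 * \sum_(v | branch v) size (coreN v) + 4 * #|z|
  + 2 * #|[pred p : V * V | core p.1 p.2 && long_run l p.1 p.2]|.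
Proof.
pose HH := [pred p : V * V | [&& hub p.1, hub p.2 & p.2 \in L p.1]].
pose U := [pred p : V * V |
   [&& ~~ hub p.1, hub p.2, p.2 \in L p.1 & attach (piece p.1) != Some p]].
pose U' := [pred p : V * V | U (p.2, p.1)].
pose C := [pred p : V * V | core p.1 p.2 && cut p.1 p.2].
have cU' : #|U'| = #|U|.
  by rewrite (card_swap (fun x y => U (x, y))); apply: eq_card => -[].
have : removed d s l L z <= #|HH| + (#|U| + (#|U'| + #|C|)).
  apply: leq_trans (card_predU_le (C := [predU U & [predU U' & C]]) (B := HH) _) _; last first.
    rewrite leq_add2l; apply: leq_trans (card_predU_le (C := [predU U' & C]) (B := U) _) _ => //.
    by rewrite leq_add2l; apply: card_predU_le.
  move=> [x y] /andP[/= xy]; rewrite /kept !negb_or => /and3P[].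
  rewrite mem_pieceN mem_lowN // xy !inE /= xy -L_sym xy !andbT /=.
  case hx: (hub x); case hy: (hub y) => //=; rewrite ?orbF ?orbT // .
  - by move=> _ _ ->.
  - by move=> _ -> .
  - by rewrite negb_imply negbK => -> _ _.
have := card_hub_hub; have := card_unattached; have := card_cut.
by rewrite cU' -/HH -/U -/C; lia.
Qed.

End Counting.

(** * Statistics of the decomposition *)

Lemma card_partition_by (T I : finType) (P : pred T) (k : T -> I) :
  #|P| = \sum_i #|[pred x | P x && (k x == i)]|.
Proof.
rewrite -sum1_card (partition_big k predT) //=.
by apply: eq_bigr => i _; rewrite sum1_card; apply: eq_card => x; rewrite !inE.
Qed.

(** Inside each class, elements are matched position by position in the enumeration; those beyond
    the size of the other class stay unmatched, and truncated subtraction counts them. The label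
    [None] is never matched. *)
Lemma partial_matching (T I : finType) (a b : T -> option I) :
  exists m : rel T,
   [/\ forall x y, m x y -> a x != None /\ a x = b y,
       forall x y y', m x y -> m x y' -> y = y',
       forall x x' y, m x y -> m x' y -> x = x',
       forall i, #|[pred x | (a x == Some i) && ~~ [exists y, m x y]]| <=
         #|[pred x | a x == Some i]| - #|[pred y | b y == Some i]|
     & forall i, #|[pred y | (b y == Some i) && ~~ [exists x, m x y]]| <=
         #|[pred y | b y == Some i]| - #|[pred x | a x == Some i]|].
Proof.
pose E (c : T -> option I) o := enum [pred x | c x == o].
have memE c x : x \in E c (c x) by rewrite mem_enum inE.
pose m x y := [&& a x != None, a x == b y & index x (E a (a x)) == index y (E b (b y))].
have unmatched (c c' : T -> option I) (m' : rel T) i :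
    (forall x y, c x = Some i -> c' y = Some i ->
       index x (E c (Some i)) = index y (E c' (Some i)) -> m' x y) ->
    #|[pred x | (c x == Some i) && ~~ [exists y, m' x y]]| <=
      #|[pred x | c x == Some i]| - #|[pred y | c' y == Some i]|.
  move=> mP; rewrite ![#|[pred x | _ == Some i]|]cardE -size_drop.
  apply: leq_trans (card_size _); apply: subset_leq_card; apply/subsetP => x.
  rewrite inE => /andP[/eqP cx /existsPn no].
  have xE : x \in E c (Some i) by rewrite -cx.
  have := xE; rewrite -[X in x \in X -> _](cat_take_drop (size (E c' (Some i)))).
  rewrite mem_cat in_take // => /orP[lt|//].
  have := mem_nth x lt; rewrite mem_enum inE => /eqP cy.
  have /negP[] := no (nth x (E c' (Some i)) (index x (E c (Some i)))).
  by apply: mP => //; rewrite index_uniq ?enum_uniq.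
exists m; split.
- by move=> x y /and3P[ne /eqP ab _].
- move=> x y y' /and3P[_ /eqP ab /eqP i1] /and3P[_ /eqP ab' /eqP i2].
  have yE : y \in E b (b y') by rewrite -ab' ab.
  move: i2; rewrite i1 -ab ab' => /(congr1 (nth y (E b (b y')))).
  by rewrite !nth_index.
- move=> x x' y /and3P[_ /eqP ab /eqP i1] /and3P[_ /eqP ab' /eqP i2].
  have xE : x \in E a (a x') by rewrite ab' -ab.
  move: i2; rewrite -i1 ab -ab' => /(congr1 (nth x (E a (a x')))).
  by rewrite !nth_index.
- move=> i; apply: (unmatched a b m) => x y ax byi ixy.
  by rewrite /m ax byi !eqxx ixy eqxx.
- move=> i; apply: (unmatched b a (fun y x => m x y)) => y x byi ax ixy.
  by rewrite /m ax byi !eqxx ixy eqxx.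
Qed.

(** Domain and codomain of [M] have equal size, so the remaining elements of both sides are matched
    as a single class. *)
Lemma extend_matching (T : finType) (M : rel T) :
  (forall x y y', M x y -> M x y' -> y = y') ->
  (forall x x' y, M x y -> M x' y -> x = x') ->
  exists2 f : T -> T, injective f & forall x y, M x y -> f x = y.
Proof.
move=> inj1 inj2.
pose a x := if [exists y, M x y] then None else Some tt.
pose b y := if [exists x, M x y] then None else Some tt.
have [m [mP m1 m2 ua _]] := partial_matching a b.
pose dom := [pred x | [exists y, M x y]]; pose cod := [pred y | [exists x, M x y]].
have cardDC : #|dom| = #|cod|.
  pose g x := odflt x [pick y | M x y].
  have gP x : x \in dom -> M x (g x).
    by rewrite inE /g => /existsP[y Mxy]; case: pickP => [//|/(_ y)]; rewrite Mxy.
  rewrite -(card_in_imset (f := g)) => [|x x' xD x'D E]; last first.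
    by apply: inj2 (gP x xD) _; rewrite E; apply: gP.
  apply: eq_card => y; rewrite [in RHS]inE; apply/imsetP/existsP => [[x xD ->]|[x Mxy]].
    by exists x; apply: gP.
  have xD : x \in dom by rewrite inE; apply/existsP; exists y.
  by exists x => //; apply: inj1 Mxy (gP x xD).
have m_total x : ~~ [exists y, M x y] -> exists y, m x y.
  move=> nM; apply/existsP; apply: contraT => nm.
  have : 0 < #|[pred x | (a x == Some tt) && ~~ [exists y, m x y]]|.
    by apply/card_gt0P; exists x; rewrite inE /a (negPf nM) eqxx.
  rewrite lt0n => /negP[]; rewrite -leqn0; apply: leq_trans (ua tt) _.
  rewrite leqn0 subn_eq0.
  have -> : #|[pred x | a x == Some tt]| = #|[predC dom]|.
    by apply: eq_card => x'; rewrite !inE /a; case: ifP.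
  have -> : #|[pred y | b y == Some tt]| = #|[predC cod]|.
    by apply: eq_card => x'; rewrite !inE /b; case: ifP.
  by rewrite -(leq_add2l #|dom|) cardC cardDC cardC.
pose N x y := M x y || m x y.
have N_total x : exists y, N x y.
  have [/existsP[y Mxy]|/m_total[y mxy]] := boolP [exists y, M x y].
    by exists y; rewrite /N Mxy.
  by exists y; rewrite /N mxy orbT.
have Mm x y : M x y -> m x y = false.
  move=> Mxy; apply/negP => /mP[]; rewrite /a; case: ifP => // /existsP[].
  by exists y.
have M_free x y x' y' : M x y -> m x' y' -> (x != x') && (y != y').
  move=> Mxy mxy'; have [ax E] := mP _ _ mxy'.
  apply/andP; split; apply/eqP => F; move: ax; last rewrite E.
    by rewrite /a; case: ifP => // /existsP[]; exists y; rewrite -F.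
  by rewrite /b; case: ifP => // /existsP[]; exists x; rewrite -F.
pose f x := odflt x [pick y | N x y].
have fP x : N x (f x).
  by rewrite /f; case: pickP => // no; have [y] := N_total x; rewrite no.
exists f => [x x' E|x y Mxy].
  have := fP x; have := fP x'; rewrite -E => /orP[h|h] /orP[h'|h'].
  - exact: inj2 h' h.
  - by have := M_free _ _ _ _ h h'; rewrite eqxx andbF.
  - by have := M_free _ _ _ _ h' h; rewrite eqxx andbF.
  - exact: m2 h' h.
have /orP[h|h] := fP x; first exact: inj1 h Mxy.
by have := M_free _ _ _ _ Mxy h; rewrite eqxx.
Qed.

Definition forest_lists (V : finType) (L : V -> seq V) :=
  [/\ forall v, uniq (L v), forall v w, (w \in L v) = (v \in L w),
      forall v, v \notin L v
    & forall c : seq V, 2 < size c -> ~ ucycle (fun x y => y \in L x) c].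

(* Adjacency matrix, size and attachment point of a piece, with respect to the
   enumeration of its vertices. *)
Definition piece_type S : finType :=
  ({ffun 'I_S * 'I_S -> bool} * 'I_S.+1 * {ffun 'I_S -> bool})%type.

(* Position of the leading bit and next bits of the degree (which determine the
   degree up to a factor [1 + 1/g]), and number of samples of each petal type. *)
Definition hub_class (g m S B : nat) : finType :=
  ('I_B.+1 * 'I_(g.*2.+1) * {ffun piece_type S -> 'I_m.+1})%type.

(** A graph with the random choices that fix its statistics. The samples are plain numbers because
    each hub reduces them modulo its own degree. *)
Record sampled_lists (V : Type) (m : nat) := SampledLists {
  lists : V -> seq V;
  cuts : pred V;
  samples : 'I_m -> nat }.

Section Statistics.
Variables (d s l g m : nat) (V : finType).
Notation S := (d.+1 ^ (s.*2 + l)).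
Notation T := (piece_type S).
Notation K := (hub_class g m S (trunc_log 2 #|V|)).

Section OneGraph.
Variable I : sampled_lists V m.
Notation L := (lists I).
Notation z := (cuts I).
Notation hub := (hub d L).
Notation pieceN := (pieceN d s l L z).
Notation piece := (piece d s l L z).
Notation attach := (attach d L).

Definition type_of (A : {set V}) : T :=
  ([ffun ij : 'I_S * 'I_S =>
      if onth (enum A) ij.1 is Some x then
        if onth (enum A) ij.2 is Some y then y \in pieceN x else false
      else false],
   inord #|A|,
   [ffun i : 'I_S =>
      if attach A is Some (x, _) then onth (enum A) i == Some x else false]).

(* A representative of each piece: its attachment point if it has one. *)
Definition rep v :=
  if attach (piece v) is Some (x, _) then x else head v (enum (piece v)).

(** A petal of [h] is a piece attached to [h]; a neighbor of [h] that is not the attachment point of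
    such a piece yields [None]. *)
Definition petal h i : option T :=
  if onth (L h) i is Some u then
    if ~~ hub u && (attach (piece u) == Some (u, h)) then Some (type_of (piece u))
    else None
  else None.

Definition petals h (t : T) :=
  #|[pred u | [&& ~~ hub u, attach (piece u) == Some (u, h) & type_of (piece u) == t]]|.

Definition sampled_petals h (t : T) :=
  #|[pred j : 'I_m | petal h (samples I j %% size (L h)) == Some t]|.

Definition class_of h : K :=
  (inord (trunc_log 2 (size (L h))),
   inord (size (L h) * g %/ 2 ^ trunc_log 2 (size (L h))),
   [ffun t => inord (sampled_petals h t)]).

(** Only representatives carry a label, so labelled vertices count every piece once and uniformly
    random vertices estimate these counts. *)
Definition label v : option (option K * T) :=
  if ~~ hub v && (rep v == v) then
    Some (omap (fun e => class_of e.2) (attach (piece v)), type_of (piece v))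
  else None.

Definition label_count (c : option K * T) := #|[pred v | label v == Some c]|.

(* The sampled frequency of every petal type is within [1/g] of the true one. *)
Definition well_sampled h := [forall t,
  (g * m * petals h t <= g * size (L h) * sampled_petals h t + m * size (L h)) &&
  (g * size (L h) * sampled_petals h t <= g * m * petals h t + m * size (L h))].

(** Bounds the number of petals at badly sampled hubs, which are left out of the matching. *)
Definition ill_degree := \sum_(h | hub h && ~~ well_sampled h) size (L h).

Hypothesis FL : forest_lists L.
Let L_uniq : forall v, uniq (L v). Proof. by case: FL. Qed.
Let L_sym : forall v w, (w \in L v) = (v \in L w). Proof. by case: FL. Qed.
Let L_irr : forall v, v \notin L v. Proof. by case: FL. Qed.
Let L_acyclic : forall c : seq V, 2 < size c -> ~ ucycle (fun x y => y \in L x) c.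
Proof. by case: FL. Qed.

Lemma rep_piece v : rep v \in piece v.
Proof.
rewrite /rep; case E: (attach _) => [[x h]|]; first by have [] := attachP E.
have : v \in piece v by apply: piece_refl.
rewrite -mem_enum.
by case E': (enum _) => [|w q] //= _; rewrite -mem_enum E' mem_head.
Qed.

Lemma rep_eq x y : y \in piece x -> rep y = rep x.
Proof.
move=> yx; rewrite /rep (piece_eq L_sym yx); case: attach => [[]|] //.
have : x \in piece x by apply: piece_refl.
rewrite -mem_enum.
by case: (enum _).
Qed.

Lemma rep_idem v : rep (rep v) = rep v.
Proof. exact/rep_eq/rep_piece. Qed.

Lemma piece_rep v : piece (rep v) = piece v.
Proof. exact/piece_eq/rep_piece. Qed.

Lemma hub_rep v : hub (rep v) = hub v.
Proof. exact: piece_hub (rep_piece v). Qed.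

Definition hub_of v := if attach (piece v) is Some (_, h) then h else v.

Lemma label_attached v k t : (label v == Some (Some k, t)) =
  [&& ~~ hub v, if attach (piece v) is Some (x, h) then (x == v) && (class_of h == k) else false
    & type_of (piece v) == t].
Proof.
rewrite /label /rep; case: (hub v) => //=.
case: (attach (piece v)) => [[x h]|] /=; last by case: ifP.
by case: (x == v).
Qed.

Lemma label_free v t : (label v == Some (None, t)) =
  [&& ~~ hub v, rep v == v, attach (piece v) == None & type_of (piece v) == t].
Proof.
rewrite /label; case: (hub v) => //=; case: (rep v == v) => //=.
by case: (attach (piece v)).
Qed.

Lemma label_count_hubs k t :
  label_count (Some k, t) = \sum_(h | hub h && (class_of h == k)) petals h t.
Proof.
rewrite /label_count (card_partition_by _ hub_of) [RHS]big_mkcond.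
apply: eq_bigr => h _; case: ifP => [/andP[hh /eqP ck]|hk].
  apply: eq_card => v; rewrite !inE label_attached /hub_of.
  case: (hub v) => //=; case E: (attach (piece v)) => [[x h']|] //=.
  rewrite -[Some _ == Some _]/((x == v) && (h' == h)).
  have [->|] := eqVneq h' h; last by rewrite !andbF.
  by rewrite ck eqxx !andbT.
apply: eq_card0 => v; rewrite !inE label_attached /hub_of.
case hv: (hub v) => //=; case E: (attach (piece v)) => [[x h']|] //=.
apply/negP => /andP[/andP[/andP[_ c1] _] /eqP E2].
by have [_ _ hh _] := attachP E; rewrite -E2 hh c1 in hk.
Qed.

Lemma sum_petals h : \sum_t petals h t <= size (L h).
Proof.
apply: leq_trans (card_size _); rewrite /petals.
rewrite (eq_bigr (fun t => #|[pred u | [pred u | ~~ hub u && (attach (piece u) == Some (u, h))] u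
    && (type_of (piece u) == t)]|)) => [|t _]; last by apply: eq_card => u; rewrite !inE andbA.
rewrite -card_partition_by; apply: subset_leq_card; apply/subsetP => u.
by rewrite inE => /andP[_ /eqP/attachP[_ _ _]]; rewrite L_sym.
Qed.

Lemma size_L_le v : size (L v) <= #|V|.
Proof. by rewrite -(card_uniqP (L_uniq v)) max_card. Qed.

Lemma sampled_petals_le h t : sampled_petals h t <= m.
Proof. by rewrite -[leqRHS]card_ord max_card. Qed.

End OneGraph.
End Statistics.
Arguments rep_piece {d s l m V I}.
Arguments rep_eq {d s l m V I} FL {x y}.
Arguments rep_idem {d s l m V I}.
Arguments piece_rep {d s l m V I}.
Arguments hub_rep {d s l m V I}.
Arguments sum_petals {d s l m V I}.
Arguments size_L_le {m V I}.
Arguments sampled_petals_le {d s l m V}.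
Arguments label_count_hubs {d s l g m V I}.
Arguments label_free {d s l g m V I}.
Arguments label_attached {d s l g m V I}.

(** * Graphs with close statistics *)

Section Similarity.
Variables (d s l g m : nat) (V : finType).
Notation S := (d.+1 ^ (s.*2 + l)).
Notation T := (piece_type S).
Notation hub I := (hub d (lists I)).
Notation piece I := (piece d s l (lists I) (cuts I)).
Notation attach I := (attach d (lists I)).
Notation kept I := (kept d s l (lists I) (cuts I)).
Notation removed I := (removed d s l (lists I) (cuts I)).
Notation type_of := (@type_of d s l m V).
Notation rep := (@rep d s l m V).
Notation petals := (@petals d s l m V).
Notation sampled_petals := (@sampled_petals d s l m V).
Notation class_of := (@class_of d s l g m V).
Notation label := (@label d s l g m V).
Notation label_count := (@label_count d s l g m V).
Notation well_sampled := (@well_sampled d s l g m V).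
Notation ill_degree := (@ill_degree d s l g m V).
Notation deg I v := (size (lists I v)).

Lemma inord_inj_le n i j : i <= n -> j <= n -> inord i = inord j :> 'I_n.+1 -> i = j.
Proof. by move=> hi hj /(congr1 val); rewrite /= !inordK. Qed.

(** Equal classes have equal sample counts and degrees equal up to a factor [1 + 1/g]; each petal
    count is within [1/g] of the degree from the value that the samples predict. *)
Lemma class_close (I J : sampled_lists V m) h h' t :
  forest_lists (lists I) -> forest_lists (lists J) -> 0 < m ->
  hub I h -> hub J h' -> well_sampled I h -> well_sampled J h' ->
  class_of I h = class_of J h' ->
  g * petals I h t <= g * petals J h' t + 2 * (deg I h + deg J h').
Proof.
move=> FI FJ m0 hI hJ /forallP/(_ t)/andP[wI _] /forallP/(_ t)/andP[_ wJ].
have D0 : 0 < deg I h by apply: leq_ltn_trans hI.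
have D0' : 0 < deg J h' by apply: leq_ltn_trans hJ.
have DV : deg I h <= #|V| := size_L_le FI h.
have DV' : deg J h' <= #|V| := size_L_le FJ h'.
case=> e1 e2 /ffunP/(_ t); rewrite !ffunE => e3.
have {}e3 : sampled_petals I h t = sampled_petals J h' t.
  by apply: inord_inj_le e3; apply: sampled_petals_le.
have {}e1 : trunc_log 2 (deg I h) = trunc_log 2 (deg J h').
  by apply: inord_inj_le e1; apply: leq_trunc_log.
(* The quotient fits the range of [inord] in [class_of], so equal classes have equal quotients. *)
have quo_le D : 0 < D -> D * g %/ 2 ^ trunc_log 2 D <= g.*2.
  move=> D1; have p0 : 0 < 2 ^ trunc_log 2 D by rewrite expn_gt0.
  rewrite -[leqRHS](mulnK _ p0); apply: leq_div2r.
  have := trunc_log_ltn D (isT : 1 < 2); rewrite expnS; nia.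
have {}e2 : deg I h * g %/ 2 ^ trunc_log 2 (deg I h) = deg J h' * g %/ 2 ^ trunc_log 2 (deg J h').
  by apply: inord_inj_le e2; apply: quo_le.
(* Equal quotients by the same power of 2 leave a difference below this power, which is at most the
   degree. *)
have key : deg I h * g <= deg J h' * g + deg J h'.
  have p2 : 2 ^ trunc_log 2 (deg J h') <= deg J h' by apply: trunc_logP.
  apply: leq_trans (_ : deg J h' * g + 2 ^ trunc_log 2 (deg J h') <= _); last by rewrite leq_add2l.
  have := ltn_ceil (deg I h * g) (expn_gt0 2 (trunc_log 2 (deg I h))).
  have := leq_divM (deg J h' * g) (2 ^ trunc_log 2 (deg J h')).
  by rewrite e2 e1 mulSn; lia.
have XM := sampled_petals_le J h' t.
rewrite e3 in wI; rewrite -(leq_pmul2l m0).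
move: key XM wI wJ; move: (sampled_petals J h' t) (deg I h) (deg J h') (petals I h t) (petals J h' t).
move=> X D D' x x' key XM wI wJ.
have k1 := leq_mul key (leqnn X); have k2 := leq_mul (leqnn D') XM.
by lia.
Qed.

(** * Edges lost under a matching of hubs and pieces *)

Section Pair.
Variables (I J : sampled_lists V m) (m1 m2 : rel V).
Hypothesis FI : forest_lists (lists I).
Hypothesis FJ : forest_lists (lists J).

Definition compatible :=
  [/\ forall h h', m1 h h' -> hub I h /\ hub J h',
      forall r r', m2 r r' -> [/\ ~~ hub I r, ~~ hub J r', rep I r = r, rep J r' = r'
         & type_of I (piece I r) = type_of J (piece J r')]
    & forall r r', m2 r r' ->
        match attach I (piece I r), attach J (piece J r') with
        | None, None => true
        | Some e, Some e' => m1 e.2 e'.2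
        | _, _ => false
        end].

(** Types are written in the order of [enum], so equal positions define an isomorphism between
    matched pieces. *)
Definition vmatch v v' := (hub I v == hub J v') &&
  if hub I v then m1 v v' else
  m2 (rep I v) (rep J v') && (index v (enum (piece I v)) == index v' (enum (piece J v'))).

Definition unmatched := [pred r | [&& ~~ hub I r, rep I r == r & ~~ [exists r', m2 r r']]].

Lemma vmatch_fun :
  (forall h h' h'', m1 h h' -> m1 h h'' -> h' = h'') ->
  (forall r r' r'', m2 r r' -> m2 r r'' -> r' = r'') ->
  forall v v' v'', vmatch v v' -> vmatch v v'' -> v' = v''.
Proof.
move=> f1 f2 v v' v'' /andP[/eqP hv]; rewrite /vmatch; case: (hub I v) hv => hv.
  by move=> h' /andP[_ h'']; apply: f1 h' h''.
move=> /andP[h' /eqP i'] /andP[_ /andP[h'' /eqP i'']].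
have E := f2 _ _ _ h' h''.
have pE : piece J v' = piece J v'' by rewrite -(piece_rep FJ v') E piece_rep.
move: i''; rewrite i' pE => /(congr1 (nth v' (enum (piece J v'')))).
have JS : forall v w, (w \in lists J v) = (v \in lists J w) by case: FJ.
have a' : v' \in piece J v'' by rewrite -pE; apply: piece_refl.
have a'' : v'' \in piece J v'' by apply: piece_refl.
by rewrite !nth_index ?mem_enum.
Qed.

Section Lost.
Hypothesis comp : compatible.

Lemma type_eq_onth r r' (x : V) : m2 r r' -> x \in piece I r ->
  exists2 x', x' \in piece J r' & index x' (enum (piece J r')) = index x (enum (piece I r)).
Proof.
have [_ h _] := comp => /h[_ _ _ _ [_ eS _]] xr.
have cE : #|piece I r| = #|piece J r'| by apply: inord_inj_le eS; apply: card_piece.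
have lt : index x (enum (piece I r)) < size (enum (piece J r')).
  by rewrite -cardE -cE cardE index_mem mem_enum.
exists (nth x (enum (piece J r')) (index x (enum (piece I r)))).
  by rewrite -mem_enum mem_nth.
by rewrite index_uniq ?enum_uniq.
Qed.

Lemma onth_index (A : {set V}) x : x \in A -> onth (enum A) (index x (enum A)) = Some x.
Proof.
move=> xA; rewrite onthE (nth_map x) ?nth_index ?mem_enum //.
by rewrite index_mem mem_enum.
Qed.

Lemma onth_uniq_index (q : seq V) x i : uniq q -> onth q i = Some x -> index x q = i.
Proof.
move=> U E; have lt : i < size q by rewrite -onthTE E.
by rewrite -{1}(onth_nth x _ _ _ E) index_uniq.
Qed.

Lemma index_lt (A : {set V}) x : x \in A -> #|A| <= S -> index x (enum A) < S.
Proof. by move=> xA le; apply: leq_trans le; rewrite cardE index_mem mem_enum. Qed.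

(** Matched pieces have equal adjacency matrices and attachment positions, and their hubs are
    matched, so all kept edges at a matched piece survive. *)
Lemma lost_unmatched (f : V -> V) x y : (forall v v', vmatch v v' -> f v = v') ->
  kept I x y -> f y \notin lists J (f x) ->
  (~~ hub I x && unmatched (rep I x)) || (~~ hub I y && unmatched (rep I y)).
Proof.
have [cI cA cB] := comp; move=> fP.
have [IU IS _ _] := FI; have [JU JS _ _] := FJ.
have matched v : ~~ hub I v -> ~~ unmatched (rep I v) -> exists r', m2 (rep I v) r'.
  move=> hv; rewrite /unmatched /= hub_rep // hv rep_idem // eqxx /= negbK.
  by move/existsP.
have in_piece v r' v' : ~~ hub I v -> m2 (rep I v) r' -> v' \in piece J r' ->
    index v' (enum (piece J r')) = index v (enum (piece I v)) -> f v = v'.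
  move=> hv mr v'r iE; apply: fP.
  have [_ hr' _ rr' _] := cA _ _ mr.
  rewrite /vmatch (piece_hub JS v'r) (negPf hv) (negPf hr') eqxx /=.
  by rewrite (rep_eq FJ v'r) rr' mr (piece_eq JS v'r) iE eqxx.
have attach_case v h : attach I (piece I v) = Some (v, h) -> ~~ unmatched (rep I v) ->
    f h \in lists J (f v).
  move=> E; have [_ hv hh _] := attachP E.
  have rv : rep I v = v by rewrite /rep E.
  move=> /(matched v hv)[r' mr]; have := cB _ _ mr; rewrite rv in mr *.
  rewrite E; case E': (attach J (piece J r')) => [[x' h']|] //= mh.
  have [_ _ _ rr' tE] := cA _ _ mr.
  have x'r : x' = r' by rewrite -rr' /rep E'.
  rewrite {}x'r in E'; have [_ hr' hh' h'L] := attachP E'.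
  have -> : f h = h'.
    by apply: fP; rewrite /vmatch hh hh' /=.
  suff -> : f v = r' by [].
  have vp : v \in piece I v by apply: piece_refl.
  have vS : index v (enum (piece I v)) < S by apply: index_lt vp _; apply: card_piece.
  have r'p : r' \in piece J r' by apply: piece_refl.
  apply: (in_piece _ r') => //; first by rewrite rv.
  case: tE => _ _ /ffunP/(_ (Ordinal vS)); rewrite !ffunE E E' /= onth_index // eqxx.
  by move/esym/eqP/(onth_uniq_index (enum_uniq _)).
move=> k; apply: contraNT => /norP[/nandP ux /nandP uy].
case/or3P: k => [xy|/andP[hx /eqP E]|/andP[hy /eqP E]]; last 2 first.
- by apply: attach_case E _; case: ux; rewrite ?hx.
- by rewrite JS; apply: attach_case E _; case: uy; rewrite ?hy.
have hx : ~~ hub I x by move: xy; rewrite mem_pieceN // mem_lowN => /andP[/and3P[]].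
have yx : y \in piece I x by rewrite mem_piece //; apply: connect1.
have hy : ~~ hub I y by rewrite (piece_hub IS yx).
have [//||r' mr] := matched x; first by case: ux; rewrite ?hx.
have pE : piece I (rep I x) = piece I x by apply: piece_rep.
have xx : x \in piece I x by apply: piece_refl.
have xr : x \in piece I (rep I x) by rewrite pE.
have yr : y \in piece I (rep I x) by rewrite pE.
have [x' x'r] := type_eq_onth mr xr; rewrite pE => ix.
have [y' y'r] := type_eq_onth mr yr; rewrite pE => iy.
have -> : f x = x' by apply: in_piece mr x'r ix.
have -> : f y = y'.
  apply: in_piece y'r _ => //; first by rewrite (rep_eq FI yx).
  by rewrite iy (piece_eq IS yx).
have [_ _ _ _ [tE _ _]] := cA _ _ mr.
have cS : #|piece I x| <= S by apply: card_piece.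
move/ffunP/(_ (Ordinal (index_lt xx cS), Ordinal (index_lt yx cS))): tE.
rewrite !ffunE /= pE !onth_index // -ix -iy !onth_index // xy => /esym.
by rewrite mem_pieceN // mem_lowN => /andP[/and3P[]].
Qed.

(** A lost dart is removed or has an end in an unmatched piece; such a piece has at most [S]
    vertices of degree at most [d], and both directions count. *)
Lemma lost_darts (f : V -> V) : (forall v v', vmatch v v' -> f v = v') ->
  #|[pred p : V * V | (p.2 \in lists I p.1) && (f p.2 \notin lists J (f p.1))]| <=
  removed I + 2 * (S * #|unmatched| * d).
Proof.
move=> fP; have [IU IS _ _] := FI.
pose lonely := [pred v | ~~ hub I v && unmatched (rep I v)].
have cL : #|lonely| <= S * #|unmatched|.
  rewrite -[#|lonely|]cardsE; apply: leq_trans (_ : #|\bigcup_(r in unmatched) piece I r| <= _).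
    apply: subset_leq_card; apply/subsetP => v; rewrite inE => /andP[_ u].
    by apply/bigcupP; exists (rep I v) => //; rewrite piece_rep // piece_refl.
  apply: leq_trans (_ : \sum_(r in unmatched) #|piece I r| <= _).
    elim/big_rec2: _ => [|r a B _ le]; first by rewrite cards0.
    by apply: leq_trans (leq_card_setU _ _) _; rewrite leq_add2l.
  rewrite mulnC -sum_nat_const; apply: leq_sum => r _; exact: card_piece.
pose D := [pred p : V * V | lonely p.1 && (p.2 \in lists I p.1)].
have cD : #|D| <= S * #|unmatched| * d.
  rewrite (card_darts _ IU); apply: leq_trans (leq_mul cL (leqnn d)).
  rewrite -sum_nat_const; apply: leq_sum => v /andP[hv _]; by rewrite leqNgt.
have cD' : #|[pred p : V * V | D (p.2, p.1)]| = #|D|.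
  by rewrite (card_swap (fun x y => D (x, y))); apply: eq_card => -[].
rewrite mul2n -addnn; apply: leq_trans (_ : _ <= removed I + (#|D| + #|D|)) _; last first.
  by rewrite leq_add2l leq_add.
rewrite -{2}cD'; apply: leq_trans (card_predU_le (C := [predU D & [pred p : V * V | D (p.2, p.1)]])
  (B := [pred p : V * V | (p.2 \in lists I p.1) && ~~ kept I p.1 p.2]) _) _; last first.
  by rewrite leq_add2l; apply: card_predU_le.
move=> [x y] /andP[/= xy lost]; have yx : x \in lists I y by rewrite IS.
have [k|nk] := boolP (kept I x y); apply/orP; [right | left]; last by apply/andP.
by case/orP: (lost_unmatched fP k lost) => u; apply/orP; [left | right]; apply/andP.
Qed.

End Lost.

Definition well_hubs k := [pred h | [&& hub I h, well_sampled I h & class_of I h == k]].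

Definition unmatched_free t :=
  #|[pred r | [&& r \in unmatched, attach I (piece I r) == None & type_of I (piece I r) == t]]|.

Definition unmatched_petals h t :=
  #|[pred r | [&& r \in unmatched, attach I (piece I r) == Some (r, h)
    & type_of I (piece I r) == t]]|.

Lemma unmatched_petals_le h t : unmatched_petals h t <= petals I h t.
Proof.
apply: subset_leq_card; apply/subsetP => r; rewrite !inE.
by move=> /and3P[/and3P[-> _ _] -> ->].
Qed.

Lemma card_unmatched :
  #|unmatched| <= \sum_t (unmatched_free t + \sum_(h | hub I h) unmatched_petals h t).
Proof.
rewrite (card_partition_by _ (fun r => type_of I (piece I r))); apply: leq_sum => t _.
pose P r := (r \in unmatched) && (type_of I (piece I r) == t).
pose A := [pred r | P r && (attach I (piece I r) != None)].
apply: leq_trans (card_predU_le (C := A) (B := [pred r | [&& r \in unmatched,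
   attach I (piece I r) == None & type_of I (piece I r) == t]]) _) _.
  by move=> r; rewrite /A /P /= inE => /andP[-> ->] /=; case: eqP.
rewrite leq_add2l (card_partition_by _ (hub_of d s l I)) [leqRHS]big_mkcond.
apply: leq_sum => h _.
have sub r : r \in [pred x | A x && (hub_of d s l I x == h)] ->
   hub I h && (r \in [pred r | [&& r \in unmatched, attach I (piece I r) == Some (r, h)
    & type_of I (piece I r) == t]]).
  rewrite !inE /A /P /= /hub_of => /andP[/andP[/andP[u tE]]].
  case E: (attach I (piece I r)) => [[x h']|] // _ /eqP E2; rewrite -E2.
  have [_ _ hh _] := attachP E; rewrite hh tE andbT /=.
  move: u; rewrite inE => /and3P[-> /eqP rr ->]; rewrite rr eqxx /=.
  by move: rr; rewrite /rep E => ->.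
case: ifP => hh; first by apply: subset_leq_card; apply/subsetP => r /sub /andP[].
by rewrite leqn0; apply/pred0P => r; apply/negP => /sub; rewrite hh.
Qed.

End Pair.

(** * The number of unmatched pieces *)

Section UnmatchedBound.
Variables (I J : sampled_lists V m) (m1 m2 : rel V).
Hypothesis FI : forest_lists (lists I).
Hypothesis FJ : forest_lists (lists J).
Hypothesis m_gt0 : 0 < m.
Hypothesis m1P : forall h h', m1 h h' ->
  [/\ hub I h, hub J h', well_sampled I h, well_sampled J h' & class_of I h = class_of J h'].
Hypothesis m1_fun : forall h h' h'', m1 h h' -> m1 h h'' -> h' = h''.
Hypothesis m1_inj : forall h h' h'', m1 h h'' -> m1 h' h'' -> h = h'.
Hypothesis m1_left : forall k,
  #|[pred h | (h \in well_hubs I k) && ~~ [exists h', m1 h h']]| <=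
  #|well_hubs I k| - #|well_hubs J k|.
Hypothesis m1_right : forall k,
  #|[pred h' | (h' \in well_hubs J k) && ~~ [exists h, m1 h h']]| <=
  #|well_hubs J k| - #|well_hubs I k|.
Hypothesis m2_free : forall t,
  unmatched_free I m2 t <= label_count I (None, t) - label_count J (None, t).
Hypothesis m2_petals : forall h h' t, m1 h h' ->
  unmatched_petals I m2 h t <= petals I h t - petals J h' t.

(** One of the truncated differences in [m1_left] and [m1_right] is zero. *)
Lemma well_hubs_match k :
  (forall h, h \in well_hubs I k -> exists h', m1 h h') \/
  (forall h', h' \in well_hubs J k -> exists h, m1 h h').
Proof.
have [le|/ltnW le] := leqP #|well_hubs I k| #|well_hubs J k|; [left|right] => h hk.
  have := m1_left k; rewrite (eqP le) leqn0 => /pred0P/(_ h) /=.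
  by rewrite hk /= => /negbFE/existsP.
have := m1_right k; rewrite (eqP le) leqn0 => /pred0P/(_ h) /=.
by rewrite hk /= => /negbFE/existsP.
Qed.

(** The inner sum is the value at the partner of [h], or zero if there is none; no partner has to be
    chosen. *)
Lemma sum_matched (F : V -> nat) k :
  \sum_(h in well_hubs I k) \sum_(h' | m1 h h') F h' =
  \sum_(h' in well_hubs J k | [exists h, m1 h h']) F h'.
Proof.
rewrite (exchange_big_dep [pred h' | (h' \in well_hubs J k) && [exists h, m1 h h']]) /=.
  apply: eq_bigr => h' /andP[/and3P[_ _ /eqP ck] /existsP[h m1h]].
  have hk : (h \in well_hubs I k) && m1 h h'.
    rewrite m1h andbT; have [hI _ wI _ cE] := m1P m1h.
    by rewrite inE hI wI cE ck eqxx.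
  by rewrite (bigD1 h) //= big1 ?addn0 // => h2 /andP[/andP[_ m2h]]; rewrite (m1_inj m2h m1h) eqxx.
move=> h h' /and3P[_ _ /eqP ck] mh; have [_ hJ _ wJ cE] := m1P mh.
by rewrite !inE hJ wJ -cE ck eqxx; apply/existsP; exists h.
Qed.

Lemma matched_sum (F : V -> nat) h h' : m1 h h' -> \sum_(h2 | m1 h h2) F h2 = F h'.
Proof.
move=> mh; rewrite (bigD1 h') //= big1 ?addn0 // => h2 /andP[m2h].
by rewrite (m1_fun m2h mh) eqxx.
Qed.

Definition ill_petals k t := \sum_(h | [&& hub J h, ~~ well_sampled J h & class_of J h == k]) petals J h t.

(* All well-sampled hubs of class [k] are matched on one of the two sides, and
   matched hubs have nearly the same number of petals of each type.  So the
   unmatched petals are accounted for by the difference of the label counts. *)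
Lemma unmatched_class k t :
  g * \sum_(h in well_hubs I k) unmatched_petals I m2 h t <=
  g * (label_count I (Some k, t) - label_count J (Some k, t)) + g * ill_petals k t
  + 2 * (\sum_(h in well_hubs I k) deg I h + \sum_(h in well_hubs J k) deg J h).
Proof.
set U := \sum_(h in _) _; set D := \sum_(h in well_hubs I k) _; set D' := \sum_(h in well_hubs J k) _.
pose E := \sum_(h in well_hubs I k) \sum_(h' | m1 h h') deg J h'.
have ED : E <= D'.
  rewrite /E sum_matched /D' [leqRHS](bigID [pred h' | [exists h, m1 h h']]) /=.
  by rewrite leq_addr.
have close h h' : m1 h h' -> g * petals I h t <= g * petals J h' t + 2 * (deg I h + deg J h') /\
    g * petals J h' t <= g * petals I h t + 2 * (deg J h' + deg I h).
  by case/m1P => hI hJ wI wJ cE; split; apply: class_close.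
have [all|all] := well_hubs_match k.
  apply: leq_trans (_ : 2 * (D + E) <= _); last first.
    by rewrite (leq_trans _ (leq_addl _ _)) // leq_mul2l leq_add2l ED.
  rewrite /U /D /E -big_split !big_distrr; apply: leq_sum => h /all[h' mh] /=.
  rewrite (matched_sum _ mh); have [c _] := close _ _ mh.
  by have := leq_mul (leqnn g) (m2_petals t mh); rewrite mulnBr; lia.
pose C := \sum_(h in well_hubs I k) \sum_(h' | m1 h h') petals J h' t.
pose X := \sum_(h in well_hubs I k) petals I h t.
have CE : C = \sum_(h in well_hubs J k) petals J h t.
  rewrite /C sum_matched; apply: eq_bigl => h'; rewrite andb_idr // => /all[h mh].
  by apply/existsP; exists h.
(* At an unmatched hub all petals may be lost. At a matched one only the truncated excess over the
   partner is, and [class_close] covers the case where the partner has more. *)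
have main : g * U + g * C <= g * X + 2 * (D + E).
  rewrite /U /C /X /D /E -big_split !big_distrr -!big_split; apply: leq_sum => h _ /=.
  have [/existsP[h' mh]|no] := boolP [exists h', m1 h h'].
    rewrite !(matched_sum _ mh); have [_ c] := close _ _ mh.
    by have := leq_mul (leqnn g) (m2_petals t mh); rewrite mulnBr; lia.
  rewrite !big_pred0 => [|h'|h']; first last.
  - by apply: contraNF no => mh; apply/existsP; exists h'.
  - by apply: contraNF no => mh; apply/existsP; exists h'.
  rewrite muln0 addn0 (leq_trans _ (leq_addr _ _)) // leq_mul2l.
  by rewrite unmatched_petals_le orbT.
have XN : X <= label_count I (Some k, t).
  rewrite label_count_hubs // [leqRHS](bigID (well_sampled I)) /=.
  apply: leq_trans (leq_addr _ _); rewrite /X leq_eqVlt; apply/orP; left; apply/eqP.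
  apply: eq_bigl => h; rewrite !inE.
  by case: (hub I h) => //; case: (well_sampled I h); rewrite ?andbT ?andbF.
have NC : label_count J (Some k, t) = C + ill_petals k t.
  rewrite CE label_count_hubs // (bigID (well_sampled J)) /=.
  congr (_ + _); apply: eq_bigl => h; rewrite ?inE;
  by case: (hub J h) => //; case: (well_sampled J h); rewrite ?andbT ?andbF.
have := leq_mul (leqnn g) XN; rewrite mulnBr NC mulnDr; lia.
Qed.

(** An unmatched piece is free, hangs from a badly sampled hub, or falls under [unmatched_class].
    Each type pays the degree error once, hence the factor [#|T|]. *)
Lemma unmatched_bound : g * #|unmatched I m2| <=
  g * \sum_t \sum_o (label_count I (o, t) - label_count J (o, t))
  + g * (ill_degree I + ill_degree J)
  + 2 * #|T| * (\sum_h deg I h + \sum_h deg J h).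
Proof.
apply: leq_trans (leq_mul (leqnn g) (card_unmatched _ _)) _.
pose cls k t := g * (label_count I (Some k, t) - label_count J (Some k, t)) + g * ill_petals k t
  + 2 * (\sum_(h in well_hubs I k) deg I h + \sum_(h in well_hubs J k) deg J h).
pose bad t := \sum_(h | hub I h && ~~ well_sampled I h) petals I h t.
pose free t := label_count I (None, t) - label_count J (None, t).
apply: leq_trans (_ : \sum_t (g * free t + g * bad t + \sum_k cls k t) <= _).
  rewrite big_distrr; apply: leq_sum => t _ /=; rewrite mulnDr -addnA leq_add //.
    by rewrite leq_mul2l m2_free orbT.
  rewrite (bigID (well_sampled I)) mulnDr addnC leq_add //.
    rewrite leq_mul2l; apply/orP; right; apply: leq_sum => h _; exact: unmatched_petals_le.
  rewrite (partition_big (class_of I) predT) //= big_distrr; apply: leq_sum => k _ /=.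
  apply: leq_trans (unmatched_class k t); rewrite leq_mul2l; apply/orP; right.
  rewrite leq_eqVlt; apply/orP; left; apply/eqP.
  by apply: eq_bigl => h; rewrite inE andbA.
have S1 : \sum_t bad t <= ill_degree I.
  rewrite /bad exchange_big; apply: leq_sum => h _; exact: sum_petals.
have S2 : \sum_t \sum_k ill_petals k t <= ill_degree J.
  rewrite /ill_degree; under eq_bigr => t _.
    rewrite (_ : \sum_k _ = \sum_(h | hub J h && ~~ well_sampled J h) petals J h t); last first.
      rewrite [RHS](partition_big (class_of J) predT) //=; apply: eq_bigr => k _.
      by apply: eq_bigl => h; rewrite andbA.
    over.
  rewrite exchange_big; apply: leq_sum => h _; exact: sum_petals.
have S3 (Q : sampled_lists V m) : \sum_k \sum_(h in well_hubs Q k) deg Q h <= \sum_h deg Q h.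
  rewrite [leqRHS](bigID [pred h | hub Q h && well_sampled Q h]) /=; apply: leq_trans (leq_addr _ _).
  rewrite [leqRHS](partition_big (class_of Q) predT) //= leq_eqVlt; apply/orP; left; apply/eqP.
  by apply: eq_bigr => k _; apply: eq_bigl => h; rewrite inE andbA.
have S4 : \sum_t \sum_k cls k t <=
   g * (\sum_t \sum_k (label_count I (Some k, t) - label_count J (Some k, t)))
   + g * ill_degree J + 2 * #|T| * (\sum_h deg I h + \sum_h deg J h).
  have cst c : \sum_(t : T) c = #|T| * c by rewrite -sum_nat_const; apply: eq_bigl.
  have S4t t : \sum_k cls k t <=
      g * (\sum_k (label_count I (Some k, t) - label_count J (Some k, t)))
      + g * (\sum_k ill_petals k t) + 2 * (\sum_h deg I h + \sum_h deg J h).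
    by rewrite /cls 2!big_split -!big_distrr /= leq_add2l leq_mul2l big_split leq_add.
  apply: leq_trans (leq_sum _ (fun t _ => S4t t)) _.
  rewrite 2!big_split /= cst mulnA [#|T| * 2]mulnC leq_add2r -!big_distrr /=.
  by rewrite leq_add2l leq_mul2l S2 orbT.
have S5 t : \sum_o (label_count I (o, t) - label_count J (o, t)) =
   free t + \sum_k (label_count I (Some k, t) - label_count J (Some k, t)).
  rewrite (bigD1 None) //=; congr (_ + _).
  rewrite (reindex_omap Some id) => [|[]] //=.
  by apply: eq_bigl => k; rewrite eqxx.
under [X in _ <= g * X + _ + _]eq_bigr => t _ do rewrite S5.
rewrite !big_split -!big_distrr /= !(mulnDr g).
have arith a b c i j w x : x <= c + j + w -> a <= i -> b + a + x <= b + c + (i + j) + w by lia.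
by apply: arith S4 _; rewrite leq_mul2l S1 orbT.
Qed.

End UnmatchedBound.
End Similarity.

(** * Matching two instances by class and by type *)

Section SimilarityTheorem.
Variables (d s l g m : nat) (V : finType).
Notation S := (d.+1 ^ (s.*2 + l)).
Notation T := (piece_type S).
Notation hub I := (hub d (lists I)).
Notation piece I := (piece d s l (lists I) (cuts I)).
Notation attach I := (attach d (lists I)).
Notation removed I := (removed d s l (lists I) (cuts I)).
Notation type_of := (@type_of d s l m V).
Notation rep := (@rep d s l m V).
Notation class_of := (@class_of d s l g m V).
Notation label := (@label d s l g m V).
Notation label_count := (@label_count d s l g m V).
Notation well_sampled := (@well_sampled d s l g m V).
Notation ill_degree := (@ill_degree d s l g m V).
Notation well_hubs := (@well_hubs d s l g m V).
Notation compatible := (@compatible d s l m V).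
Notation vmatch := (@vmatch d s l m V).
Notation unmatched := (@unmatched d s l m V).
Notation deg I v := (size (lists I v)).

Definition mismatch (I J : sampled_lists V m) :=
  g * \sum_t \sum_o (label_count I (o, t) - label_count J (o, t))
  + g * (ill_degree I + ill_degree J)
  + 2 * #|T| * (\sum_h deg I h + \sum_h deg J h).

(** The key for matching pieces. [lab] gives matched hubs a common name, so petals are matched only
    across matched hubs; petals of a nameless hub get no key and stay unmatched. *)
Definition piece_label (I : sampled_lists V m) (lab : V -> option V) r : option (option V * T) :=
  if ~~ hub I r && (rep I r == r) then
    if attach I (piece I r) is Some (_, h) then
      if lab h is Some k then Some (Some k, type_of I (piece I r)) else None
    else Some (None, type_of I (piece I r))
  else None.

Lemma piece_label_free I lab r t :
  (piece_label I lab r == Some (None, t)) = (label I r == Some (None, t)).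
Proof.
rewrite label_free /piece_label; case: (hub I r) => //=; case: (rep I r == r) => //=.
case: (attach I (piece I r)) => [[x h]|] //=.
by case: (lab h).
Qed.

Lemma piece_label_petal I (lab : V -> option V) h k r t :
  lab h = Some k -> (forall h', lab h' = Some k -> h' = h) ->
  (piece_label I lab r == Some (Some k, t)) =
  [&& ~~ hub I r, attach I (piece I r) == Some (r, h) & type_of I (piece I r) == t].
Proof.
move=> lk inj; rewrite /piece_label /rep; case: (hub I r) => //=.
case E: (attach I (piece I r)) => [[x h']|] /=; last by case: ifP.
rewrite -[Some _ == Some (r, h)]/((x == r) && (h' == h)).
case: (x == r) => //=; case E': (lab h') => [k'|] /=.
  rewrite -[LHS]/((k' == k) && (type_of I (piece I r) == t)); congr (_ && _).
  apply/eqP/eqP => [kk|hh]; first by apply: inj; rewrite E' kk.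
  by move: E'; rewrite hh lk => -[].
by have [hh|] := eqVneq h' h; first by rewrite hh lk in E'.
Qed.

(** [u] and [v] are the numbers of pieces left unmatched on either side; [f] completes the induced
    correspondence of vertices to a permutation. *)
Theorem similarity (I J : sampled_lists V m) :
  forest_lists (lists I) -> forest_lists (lists J) -> 0 < m ->
  exists2 f : V -> V, injective f & exists u v : nat,
    [/\ #|[pred p : V * V | (p.2 \in lists I p.1) && (f p.2 \notin lists J (f p.1))]| <=
          removed I + 2 * (S * u * d),
        #|[pred p : V * V | (f p.2 \in lists J (f p.1)) && (p.2 \notin lists I p.1)]| <=
          removed J + 2 * (S * v * d),
        g * u <= mismatch I J & g * v <= mismatch J I].
Proof.
move=> FI FJ m0.
pose hub_label Q h := if hub Q h && well_sampled Q h then Some (class_of Q h) else None.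
have hub_labelE Q k : [pred h | hub_label Q h == Some k] =1 well_hubs Q k.
  move=> h; rewrite /= /hub_label andbA; case: (hub Q h && well_sampled Q h) => //=.
have [m1 [m1a m1f m1i m1l m1r]] := partial_matching (hub_label I) (hub_label J).
have m1P h h' : m1 h h' ->
    [/\ hub I h, hub J h', well_sampled I h, well_sampled J h' & class_of I h = class_of J h'].
  move=> /m1a[]; rewrite /hub_label; case: ifP => // /andP[-> ->] _.
  by case: ifP => // /andP[-> ->] /(congr1 (odflt (class_of I h))).
have {}m1l k : #|[pred h | (h \in well_hubs I k) && ~~ [exists h', m1 h h']]| <=
    #|well_hubs I k| - #|well_hubs J k|.
  rewrite -(eq_card (hub_labelE I k)) -(eq_card (hub_labelE J k)).
  apply: leq_trans (m1l k); apply: subset_leq_card; apply/subsetP => h.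
  rewrite !inE => /andP[hk ->]; rewrite andbT; by rewrite -[_ == _]/([pred h | hub_label I h == Some k] h) hub_labelE.
have {}m1r k : #|[pred h' | (h' \in well_hubs J k) && ~~ [exists h, m1 h h']]| <=
    #|well_hubs J k| - #|well_hubs I k|.
  rewrite -(eq_card (hub_labelE I k)) -(eq_card (hub_labelE J k)).
  apply: leq_trans (m1r k); apply: subset_leq_card; apply/subsetP => h.
  rewrite !inE => /andP[hk ->]; rewrite andbT; by rewrite -[_ == _]/([pred h | hub_label J h == Some k] h) hub_labelE.
(* The common name of two matched hubs is the one in [J]. *)
pose labI h := [pick h' | m1 h h'].
pose labJ h' := if [exists h, m1 h h'] then Some h' else None.
have labIP h h' : m1 h h' -> labI h = Some h'.
  by move=> mh; rewrite /labI; case: pickP => [h2 m2h|/(_ h')]; [rewrite (m1f _ _ _ mh m2h) | rewrite mh].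
have labI_inv h h' : labI h = Some h' -> m1 h h'.
  by rewrite /labI; case: pickP => // h2 mh [<-].
have labJP h h' : m1 h h' -> labJ h' = Some h'.
  by move=> mh; rewrite /labJ; case: ifP => // /existsP[]; exists h.
have labJ_inv h h' : labJ h = Some h' -> h = h'.
  by rewrite /labJ; case: ifP => // _ [].
have [m2 [m2a m2f m2i m2l m2r]] := partial_matching (piece_label I labI) (piece_label J labJ).
have comp : compatible I J m1 m2.
  pose pt r o := odflt (None, type_of I (piece I r)) o : option V * T.
  split=> [h h' /m1P[] //|r r' /m2a[]|r r' /m2a[]]; rewrite /piece_label.
    case: ifP => // /andP[hr /eqP rr] ne; case: ifP => [/andP[hr' /eqP rr']|_].
      move: ne; case: (attach I _) => [[x h]|]; case: (attach J _) => [[x' h']|].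
      - case: (labI h) => // k _; case: (labJ h') => // k'.
        by move=> /(congr1 (fun o => (pt r o).2)).
      - by case: (labI h).
      - by case: (labJ h').
      - by move=> _ /(congr1 (fun o => (pt r o).2)).
    by move=> E; rewrite E in ne.
  case: ifP => // _ ne; case: ifP => [_|_]; last by move=> E; rewrite E in ne.
  move: ne; case: (attach I _) => [[x h]|]; case: (attach J _) => [[x' h']|] //=.
  - case E: (labI h) => [k|] // _; case E': (labJ h') => [k'|] //.
    move=> /(congr1 (fun o => (pt r o).1)) [kk].
    by rewrite (labJ_inv _ _ E') -kk; apply: labI_inv.
  - by case: (labI h).
  - by case: (labJ h').
pose m1' h' h := m1 h h'; pose m2' r' r := m2 r r'.
have comp' : compatible J I m1' m2'.
  have [c1 c2 c3] := comp; split.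
  - by move=> h h' /c1[].
  - by move=> r r' /c2[].
  - by move=> r r' /c3; case: (attach J _) => [?|]; case: (attach I _).
have vm_sym v v' : vmatch J I m1' m2' v' v = vmatch I J m1 m2 v v'.
  rewrite /vmatch eq_sym; case: eqP => //= <-; by rewrite [X in _ && X]eq_sym.
have vmf v v' v'' : vmatch I J m1 m2 v v' -> vmatch I J m1 m2 v v'' -> v' = v''.
  exact: vmatch_fun.
have vmi v v' v'' : vmatch I J m1 m2 v v'' -> vmatch I J m1 m2 v' v'' -> v = v'.
  rewrite -!vm_sym; apply: vmatch_fun => // [h h1 h2 a b|r r1 r2 a b].
    exact: m1i a b.
  exact: m2i a b.
have [f injf fP] := extend_matching vmf vmi.
exists f => //; exists #|unmatched I m2|, #|unmatched J m2'|; split.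
- exact: (lost_darts FI FJ comp fP).
(* The second bound is the first with [I] and [J] exchanged, along the inverse of [f]. *)
- have := @lost_darts d s l m V J I m1' m2' FJ FI comp' (finv f) _.
  rewrite (_ : #|[pred p : V * V | _ & finv f _ \notin _]| =
    #|[pred p : V * V | (f p.2 \in lists J (f p.1)) && (p.2 \notin lists I p.1)]|).
    by apply=> v' v; rewrite vm_sym => /fP <-; rewrite finv_f.
  have injff : injective (fun p : V * V => (f p.1, f p.2)).
    by move=> [a b] [a' b'] [/injf -> /injf ->].
  rewrite -(on_card_preimset (onW_bij _ (injF_bij injff))) cardsE.
  by apply: eq_card => -[a b]; rewrite !inE -topredE /= !(finv_f injf).
- apply: (unmatched_bound FI FJ m0 m1P m1f m1i m1l m1r) => [t|h h' t mh].
  + apply: leq_trans (leq_trans (m2l (None, t)) _).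
      apply: subset_leq_card; apply/subsetP => r; rewrite !inE piece_label_free label_free.
      by move=> /and3P[/and3P[-> -> ->] -> ->].
    rewrite leq_eqVlt; apply/orP; left; apply/eqP; congr (_ - _); apply: eq_card => r;
      by rewrite !inE piece_label_free.
  + have EI r : (piece_label I labI r == Some (Some h', t)) = _ :=
      piece_label_petal I r t (labIP _ _ mh) (fun h2 e => m1i _ _ _ (labI_inv _ _ e) mh).
    have EJ r : (piece_label J labJ r == Some (Some h', t)) = _ :=
      piece_label_petal J r t (labJP _ _ mh) (fun h2 e => labJ_inv _ _ e).
    apply: leq_trans (leq_trans (m2l (Some h', t)) _).
      apply: subset_leq_card; apply/subsetP => r; rewrite !inE EI.
      by move=> /and3P[/and3P[-> _ ->] -> ->].
    rewrite leq_eqVlt; apply/orP; left; apply/eqP; congr (_ - _); apply: eq_card => r;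
      by rewrite !inE ?EI ?EJ.
- have m1P' h' h : m1' h' h ->
      [/\ hub J h', hub I h, well_sampled J h', well_sampled I h & class_of J h' = class_of I h].
    by case/m1P.
  apply: (unmatched_bound FJ FI m0 m1P' (fun h h' h'' => m1i h' h'' h)
    (fun h h' h'' => m1f h'' h h') m1r m1l) => [t|h' h t mh].
  + apply: leq_trans (leq_trans (m2r (None, t)) _).
      apply: subset_leq_card; apply/subsetP => r; rewrite !inE piece_label_free label_free.
      by move=> /and3P[/and3P[-> -> ->] -> ->].
    rewrite leq_eqVlt; apply/orP; left; apply/eqP; congr (_ - _); apply: eq_card => r;
      by rewrite !inE piece_label_free.
  + have EI r : (piece_label I labI r == Some (Some h', t)) = _ :=
      piece_label_petal I r t (labIP _ _ mh) (fun h2 e => m1i _ _ _ (labI_inv _ _ e) mh).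
    have EJ r : (piece_label J labJ r == Some (Some h', t)) = _ :=
      piece_label_petal J r t (labJP _ _ mh) (fun h2 e => labJ_inv _ _ e).
    apply: leq_trans (leq_trans (m2r (Some h', t)) _).
      apply: subset_leq_card; apply/subsetP => r; rewrite !inE EJ.
      by move=> /and3P[/and3P[-> _ ->] -> ->].
    rewrite leq_eqVlt; apply/orP; left; apply/eqP; congr (_ - _); apply: eq_card => r;
      by rewrite !inE ?EI ?EJ.
Qed.

End SimilarityTheorem.

(** * Random cuts and samples *)

Section SecondMoment.
Local Open Scope ring_scope.

Lemma sum_ffun_prod (X : finType) (t : nat) (G : 'I_t -> X -> int) :
  \sum_(f : {ffun 'I_t -> X}) \prod_i G i (f i) = \prod_i \sum_x G i x.
Proof. by rewrite bigA_distr_bigA. Qed.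

(** Independence: for distinct coordinates the mixed term has the factor [\sum_x y x], which is
    zero, so only the diagonal survives. *)
Lemma second_moment (X : finType) (t : nat) (y : X -> int) :
  \sum_x y x = 0 ->
  \sum_(f : {ffun 'I_t -> X}) (\sum_j y (f j)) ^+ 2 =
  (\sum_x y x ^+ 2) * #|X|%:R ^+ t.-1 *+ t.
Proof.
move=> y0.
pose G (j k i : 'I_t) x := (if i == j then y x else 1) * (if i == k then y x else 1).
have GE (f : {ffun 'I_t -> X}) j k : y (f j) * y (f k) = \prod_i G j k i (f i).
  by rewrite big_split /= -!big_mkcond /= !big_pred1_eq.
pose A := (\sum_x y x ^+ 2) * #|X|%:R ^+ t.-1.
have inner j k : \sum_(f : {ffun 'I_t -> X}) \prod_i G j k i (f i) = if k == j then A else 0.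
  rewrite sum_ffun_prod (bigD1 j) //=; case: eqVneq => [->|kj].
    congr (_ * _); first by apply: eq_bigr => x _; rewrite /G eqxx.
    rewrite (eq_bigr (fun=> #|X|%:R)) => [|i ij]; last first.
      rewrite (eq_bigr (fun=> 1)) => [|x _]; first by rewrite sumr_const.
      by rewrite /G (negPf ij) mulr1.
    rewrite prodr_const; congr (_ ^+ _).
    by have := cardC1 j; rewrite card_ord => <-; apply: eq_card.
  rewrite [X in X * _](_ : _ = 0) ?mul0r // -[RHS]y0; apply: eq_bigr => x _.
  by rewrite /G eqxx eq_sym (negPf kj) mulr1.
transitivity (\sum_j \sum_k \sum_(f : {ffun 'I_t -> X}) \prod_i G j k i (f i)).
  transitivity (\sum_(f : {ffun 'I_t -> X}) \sum_j \sum_k \prod_i G j k i (f i)).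
    apply: eq_bigr => f _; rewrite expr2 big_distrl /=; apply: eq_bigr => j _.
    by rewrite big_distrr /=; apply: eq_bigr => k _; rewrite GE.
  by rewrite exchange_big; apply: eq_bigr => j _; rewrite exchange_big.
transitivity (\sum_(j < t) A); last by rewrite sumr_const card_ord.
apply: eq_bigr => j _; rewrite (bigD1 j) //= inner eqxx big1 ?addr0 // => k kj.
by rewrite inner (negPf kj).
Qed.

End SecondMoment.

Lemma card_sum_nat (T : finType) (P : pred T) : #|P| = \sum_x (P x : nat).
Proof. by rewrite -sum1_card big_mkcond; apply: eq_bigr => x _; rewrite -topredE /=; case: (P x). Qed.

(* Chebyshev's inequality. *)
Lemma sampling_deviation (X : finType) (t g : nat) (P : pred X) :
  #|[pred f : {ffun 'I_t -> X} | let c := #|[pred j | P (f j)]| in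
     ~~ ((g * t * #|P| <= g * c * #|X| + t * #|X|) &&
         (g * c * #|X| <= g * t * #|P| + t * #|X|))]| * t <= g ^ 2 * #|X| ^ t.
Proof.
set bad := [pred f | _].
have [t00|t0] := posnP t; first by rewrite [X in _ * X <= _]t00 muln0.
have [X0|X0] := posnP #|X|.
  rewrite (_ : #|bad| = 0) ?mul0n //; apply: eq_card0 => f; exfalso.
  by have := card0_eq X0 (f (Ordinal t0)).
(* The centered indicator of [P], scaled by [#|X|] to be integral. *)
pose y x : int := (Posz ((P x : nat) * #|X|) - Posz #|P|)%R.
have y0 : (\sum_x y x = 0)%R.
  rewrite /y sumrB sumr_const.
  rewrite (eq_bigr (fun x => Posz (P x : nat) * Posz #|X|)%R) => [|x _]; last by rewrite PoszM.
  rewrite -mulr_suml; have -> : (\sum_x Posz (P x : nat) = Posz #|P|)%R.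
    by rewrite -(big_morph Posz PoszD erefl) -card_sum_nat.
  by rewrite -[(_ *+ _)%R]mulr_natr natz mulrC subrr.
have y_le x : (y x ^+ 2 <= (Posz #|X|) ^+ 2)%R.
  have := max_card P; rewrite /y; case: (P x) => /=; rewrite ?mul1n ?mul0n; nia.
have sumE (f : {ffun 'I_t -> X}) : (\sum_j y (f j) = Posz (#|[pred j | P (f j)]| * #|X|) - Posz (t * #|P|))%R.
  rewrite /y sumrB sumr_const card_ord; congr (_ - _)%R; last by rewrite -mulr_natr natz PoszM mulrC.
  by rewrite -(big_morph Posz PoszD erefl) -big_distrl (card_sum_nat [pred j | P (f j)]).
have SM := second_moment t y0.
have upper : (\sum_(f : {ffun 'I_t -> X}) (\sum_j y (f j)) ^+ 2 <= Posz (t * #|X| ^ t * #|X| ^ 2))%R.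
  rewrite SM; have : (\sum_x y x ^+ 2 <= \sum_(x : X) (Posz #|X|) ^+ 2)%R by apply: ler_sum.
  rewrite sumr_const => le.
  have -> : (Posz (t * #|X| ^ t * #|X| ^ 2) = (Posz #|X|) ^+ 2 *+ #|X| * #|X|%:R ^+ t.-1 *+ t)%R.
    rewrite -{2}(prednK t0) expnS -[(_ *+ t)%R]mulr_natr -[(_ *+ #|X|)%R]mulr_natr !PoszM !natz.
    by rewrite -!rmorphXn /=; lia.
  by apply: ler_wMn2r; apply: ler_wpM2r le; apply: exprn_ge0.
have lower : (Posz (#|bad| * (t * #|X|) ^ 2) <= Posz (g ^ 2) * \sum_(f : {ffun 'I_t -> X}) (\sum_j y (f j)) ^+ 2)%R.
  have -> : Posz (#|bad| * (t * #|X|) ^ 2) = (\sum_(f in bad) Posz ((t * #|X|) ^ 2))%R.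
    by rewrite sumr_const -mulr_natr natz PoszM mulrC.
  rewrite mulr_sumr big_mkcond; apply: ler_sum => f _.
  case: ifP => [fb|_]; last by rewrite mulr_ge0 // sqr_ge0.
  have dev : (Posz (t * #|X|) <= Posz g * (\sum_j y (f j)) \/
              Posz (t * #|X|) <= - (Posz g * (\sum_j y (f j))))%R.
    move: fb; rewrite sumE !inE /= negb_and -!ltnNge => /orP[]; nia.
  have -> : (Posz (g ^ 2) * (\sum_j y (f j)) ^+ 2 = (Posz g * (\sum_j y (f j))) ^+ 2)%R.
    by rewrite exprMn; congr (_ * _)%R.
  move: (Posz g * _)%R dev => e; rewrite !expr2 => dev.
  have : (0 <= Posz (t * #|X|))%R by [].
  have -> : Posz ((t * #|X|) ^ 2) = (Posz (t * #|X|) * Posz (t * #|X|))%R by rewrite -PoszM.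
  by move: (Posz (t * #|X|)) dev => k []; nia.
have := le_trans lower (ler_wpM2l (_ : 0 <= Posz (g ^ 2))%R upper) => /(_ isT).
have := X0; have := t0; move: #|bad| (#|X| ^ t) => B N t1 X1.
rewrite -PoszM lez_nat => H.
have K0 : 0 < t * #|X| ^ 2 by rewrite muln_gt0 t1 expn_gt0 X1.
rewrite -(leq_pmul2r K0); apply: leq_trans (leq_trans _ H) _.
  by rewrite expnMn; lia.
by lia.
Qed.

Lemma card_family_prod (V X : finType) (F : V -> pred X) :
  #|[pred f : {ffun V -> X} | [forall v, F v (f v)]]| = \prod_v #|F v|.
Proof.
have := card_family (fun v => F v); rewrite foldrE big_map big_enum /= => <-.
apply: eq_card => f; rewrite [LHS]inE; apply/forallP/familyP => h v; exact: h.
Qed.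

(** Under a uniform [f], vertices are cut independently with probability [1 / (M + 1)]. *)
Definition cut_of (V : finType) M (f : {ffun V -> 'I_M.+1}) : pred V :=
  fun v => f v == ord0.

Lemma card_uncut (V : finType) M (t : seq V) : uniq t ->
  #|[pred f : {ffun V -> 'I_M.+1} | all (predC (cut_of f)) t]| * M.+1 ^ size t
  = M ^ size t * M.+1 ^ #|V|.
Proof.
move=> U; pose F v := if v \in t then predC1 (ord0 : 'I_M.+1) else predT.
have -> : #|[pred f : {ffun V -> 'I_M.+1} | all (predC (cut_of f)) t]| = \prod_v #|F v|.
  rewrite -card_family_prod; apply: eq_card => f; rewrite !inE /F.
  apply/allP/forallP => [h v|h v vt]; last by have := h v; rewrite vt.
  by case: ifP => // /h.
rewrite (bigID (mem t)) /=.
rewrite (eq_bigr (fun=> M)) => [|v vt]; last first.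
  by rewrite /F vt; have := cardC1 (ord0 : 'I_M.+1); rewrite card_ord.
rewrite [X in _ * X * _](eq_bigr (fun=> M.+1)) => [|v /negPf vt]; last first.
  by rewrite /F vt; have := card_ord M.+1.
rewrite !prod_nat_const (card_uniqP U) -mulnA -expnD; congr (_ * _ ^ _).
rewrite -[in RHS](cardC (mem t)) (card_uniqP U) addnC; congr (_ + _); apply: eq_card.
Qed.

Lemma sum_card_cut (V : finType) M :
  (\sum_(f : {ffun V -> 'I_M.+1}) #|cut_of f|) * M.+1 = #|V| * M.+1 ^ #|V|.
Proof.
have cut1 (v : V) : #|[pred f : {ffun V -> 'I_M.+1} | cut_of f v]| * M.+1 = M.+1 ^ #|V|.
  have := @card_uncut V M [:: v] isT; rewrite /= !expn1.
  have := cardC [pred f : {ffun V -> 'I_M.+1} | cut_of f v]; rewrite card_ffun card_ord.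
  rewrite (_ : #|[predC _]| = #|[pred f : {ffun V -> 'I_M.+1} | ~~ cut_of f v && true]|); last first.
    by apply: eq_card => f; rewrite !inE /= andbT.
  by set a := #|_|; set b := #|_|; set N := _ ^ _; nia.
rewrite (eq_bigr (fun f => \sum_v (cut_of f v : nat))) => [|f _]; last first.
  by rewrite -sum1_card big_mkcond; apply: eq_bigr => v _; rewrite -topredE /=; case: (cut_of f v).
rewrite exchange_big big_distrl /= -sum_nat_const; apply: eq_bigr => v _.
rewrite -(cut1 v) -sum1_card [in RHS]big_mkcond; congr (_ * _).
Qed.

(** Bernoulli's inequality for [1 + 1/M], cleared of denominators. *)
Lemma bernoulli_expn M c : 0 < M -> M ^ (M * c) * c.+1 <= M.+1 ^ (M * c).
Proof.
move=> M0; have H k : M ^ k * (M + k) <= M * M.+1 ^ k.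
  elim: k => [|k IH]; first by rewrite !expn0 addn0 mul1n muln1.
  rewrite !expnS; apply: leq_trans (_ : M.+1 * (M ^ k * (M + k)) <= _).
    by move: (M ^ k) => a; nia.
  by rewrite [leqRHS]mulnCA leq_mul2l IH orbT.
by rewrite -(leq_pmul2l M0); have := H (M * c); rewrite -mulnS mulnCA.
Qed.

(** * Long runs under a random cut *)

Section LongRuns.
Variables (d s : nat) (V : finType) (L : V -> seq V).
Hypothesis L_uniq : forall v, uniq (L v).
Hypothesis L_sym : forall v w, (w \in L v) = (v \in L w).
Hypothesis L_irr : forall v, v \notin L v.
Hypothesis L_acyclic : forall c : seq V, 2 < size c -> ~ ucycle (fun x y => y \in L x) c.

Notation core := (core d s L).
Notation coreN := (coreN d s L).
Notation branch := (branch d s L).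
Notation long_run := (long_run d s L).

Fixpoint core_walk k x y : seq V :=
  if k is k'.+1 then
    y :: (if [seq w <- coreN y | w != x] is w :: _ then core_walk k' y w else [::])
  else [::].

(* Since it meets no branch vertex, the long run from [xy] is determined by the
   graph alone, and the random cut has to miss all of it. *)
Lemma long_run_walk (z : pred V) k x y : core x y -> long_run z k x y ->
  [/\ size (core_walk k x y) = k, all (predC z) (core_walk k x y)
    & nbwalk (fun a b => b \in lowN d L a) (x :: core_walk k x y)].
Proof.
elim: k x y => [|k IH] x y cxy //= /and3P[zy by_ /hasP[w wy /andP[wx lw]]].
have xy : x \in coreN y by rewrite mem_coreN core_sym.
have U : uniq (coreN y) by rewrite filter_uniq ?lowN_uniq.
have -> : [seq w <- coreN y | w != x] = [:: w].
  have : size [seq w <- coreN y | w != x] <= 1.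
    rewrite -(rem_filter x U) size_rem //; move: by_; rewrite /branch; lia.
  have : w \in [seq w <- coreN y | w != x] by rewrite mem_filter wx.
  by case: [seq w <- coreN y | w != x] => [|w' [|]] //; rewrite inE => /eqP->.
have cyw : core y w by rewrite -mem_coreN.
have [-> za nb] := IH _ _ cyw lw.
have xyN : y \in lowN d L x by case/and3P: cxy.
split=> //; first by rewrite /= zy.
rewrite /= in nb *; rewrite xyN nb andbT /=.
by case: (k) => //= k'; rewrite eq_sym.
Qed.

(** All cuts that leave a long run here miss the same [M * c] distinct vertices of [core_walk],
    which has probability [(M / (M + 1)) ^ (M * c)], at most [1 / (c + 1)]. *)
Lemma card_long_run M c x y : 0 < M -> core x y ->
  #|[pred f : {ffun V -> 'I_M.+1} | long_run (cut_of f) (M * c) x y]| * c.+1 <= M.+1 ^ #|V|.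
Proof.
move=> M0 cxy; set A := [pred f | _].
have [A0|/card_gt0P[f0 f0A]] := posnP #|A|; first by rewrite A0.
have [sz _ nb] := long_run_walk cxy f0A.
set t := core_walk (M * c) x y in sz nb.
have Ut : uniq (x :: t).
  apply: nbwalk_uniq nb; first by move=> a /=; apply/negbTE/lowN_irr.
  exact: lowN_acyclic.
have {}Ut : uniq t by case/andP: Ut.
have le : #|A| <= #|[pred f : {ffun V -> 'I_M.+1} | all (predC (cut_of f)) t]|.
  apply: subset_leq_card; apply/subsetP => f fA; rewrite inE.
  by have [] := long_run_walk cxy fA.
have E := card_uncut M Ut; rewrite sz in E.
have B := bernoulli_expn c M0.
have P0 : 0 < M ^ (M * c) by rewrite expn_gt0 M0.
rewrite -(leq_pmul2l P0) -E; apply: leq_trans (leq_mul le B).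
by rewrite mulnCA leq_mul2l leqnn orbT.
Qed.

Lemma sum_long_runs M c : 0 < M ->
  (\sum_(f : {ffun V -> 'I_M.+1})
     #|[pred p : V * V | core p.1 p.2 && long_run (cut_of f) (M * c) p.1 p.2]|) * c.+1
  <= #|V|.*2 * M.+1 ^ #|V|.
Proof.
move=> M0.
apply: leq_trans (_ : #|[pred p : V * V | p.2 \in L p.1]| * M.+1 ^ #|V| <= _); last first.
  rewrite leq_mul2r; apply/orP; right.
  have [f [rk rt]] := L_rooting L_sym L_irr L_acyclic; exact: card_darts_le rt.
rewrite (eq_bigr (fun f => \sum_(p : V * V) (core p.1 p.2 && long_run (cut_of f) (M * c) p.1 p.2 : nat)))
  => [|f _]; last first.
  by rewrite -sum1_card big_mkcond; apply: eq_bigr => p _; rewrite inE; case: ifP.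
rewrite exchange_big big_distrl /= -sum_nat_const [leqRHS]big_mkcond; apply: leq_sum => -[x y] _ /=.
have [cxy|] := boolP (core x y); last by rewrite big1.
have -> : (x, y) \in [pred p : V * V | p.2 \in L p.1].
  by case/and3P: cxy => h _ _; rewrite inE; apply: sub_lowN h.
apply: leq_trans (card_long_run c M0 cxy); rewrite leq_mul2r; apply/orP; right.
rewrite -sum1_card [leqRHS]big_mkcond; apply: leq_sum => f _ /=.
by rewrite inE; case: ifP.
Qed.

End LongRuns.

Lemma card_modn_ord (Q : pred nat) N a D : N = a * D ->
  #|[pred x : 'I_N | Q (x %% D)]| = a * #|[pred i : 'I_D | Q i]|.
Proof.
move=> ->; rewrite !card_sum_nat /=; elim: a => [|a IH]; first by rewrite big_ord0.
rewrite [LHS](_ : _ = \sum_(x < D + a * D) (Q (x %% D) : nat)) // big_split_ord mulSn -IH.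
congr (_ + _); apply: eq_bigr => i _ /=; first by rewrite modn_small.
by rewrite modnDl.
Qed.

(** Markov's inequality for a uniform [f]. *)
Lemma markov_card (F : finType) (X : F -> nat) a n :
  #|[pred f | n < a * X f]| * n <= a * \sum_f X f.
Proof.
rewrite -sum_nat_const big_distrr big_mkcond; apply: leq_sum => f _ /=.
by rewrite inE; case: ifP => // /ltnW.
Qed.

(** * Sampling the petals of hubs *)

Section HubSampling.
Variables (d s l g m N : nat) (V : finType) (L : V -> seq V) (z : pred V).
Hypothesis FL : forest_lists L.
Hypothesis N_gt0 : 0 < N.
Hypothesis N_div : forall D, 0 < D <= #|V| -> D %| N.
Notation T := (piece_type (d.+1 ^ (s.*2 + l))).
Notation petal := (@petal d s l m V).
Notation petals := (@petals d s l m V).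
Notation type_of := (@type_of d s l m V).
Notation sampled_petals := (@sampled_petals d s l m V).
Notation well_sampled := (@well_sampled d s l g m V).
Notation ill_degree := (@ill_degree d s l g m V).

(* The same samples serve at all hubs: they are reduced modulo the degree, which
   preserves uniformity because the degree divides [N]. *)
Definition with_samples (f : {ffun 'I_m -> 'I_N}) := SampledLists L z (fun j => f j : nat).

Lemma card_petal f h (t : T) :
  #|[pred i : 'I_(size (L h)) | petal (with_samples f) h i == Some t]| = petals (with_samples f) h t.
Proof.
have [LU LS _ _] := FL.
pose Q u := [&& ~~ hub d L u, attach d L (piece d s l L z u) == Some (u, h)
  & type_of (with_samples f) (piece d s l L z u) == t].
have QE (i : 'I_(size (L h))) : (petal (with_samples f) h i == Some t) = Q (nth h (L h) i).
  rewrite /petal /= onthE (nth_map h) // /Q; case: (hub d L _) => //=.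
  by case: ifP => h1; rewrite ?h1.
rewrite card_sum_nat /=; under eq_bigr => i _ do rewrite QE.
rewrite -(big_mkord xpredT (fun i => (Q (nth h (L h) i) : nat))) -(big_nth h xpredT (fun u => Q u : nat)).
transitivity (\sum_u (Q u : nat)); last by rewrite -card_sum_nat; apply: eq_card.
rewrite big_uniq //= big_mkcond; apply: eq_bigr => u _; case: ifP => // nu.
case q: (Q u) => //; case/and3P: q => _ /eqP/attachP[_ _ _].
by rewrite LS nu.
Qed.

(** Chebyshev's inequality for each type and a union bound over types. Passing from degree [D] to
    [N] multiplies the counts by [a = N / D], which cancels. *)
Lemma card_ill h : 0 < size (L h) ->
  #|[pred f | ~~ well_sampled (with_samples f) h]| * m
  <= #|T| * (g ^ 2 * N ^ m).
Proof.
move=> D0; set D := size (L h) in D0 *; have [LU LS _ _] := FL.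
have DV : D <= #|V| by apply: (size_L_le (I := SampledLists L z (fun _ : 'I_0 => 0)) FL h).
have [a Na] : exists a, N = a * D by exists (N %/ D); rewrite divnK // N_div // D0.
have a0 : 0 < a by move: N_gt0; rewrite Na muln_gt0 => /andP[].
pose P (t : T) (x : 'I_N) := petal (SampledLists L z (fun _ : 'I_m => 0)) h (x %% D) == Some t.
pose bad t := [pred f : {ffun 'I_m -> 'I_N} | let c := #|[pred j | P t (f j)]| in
     ~~ ((g * m * #|P t| <= g * c * #|'I_N| + m * #|'I_N|) &&
         (g * c * #|'I_N| <= g * m * #|P t| + m * #|'I_N|))].
have cP t f : #|P t| = a * petals (with_samples f) h t.
  have := card_modn_ord (fun i => petal (with_samples f) h i == Some t) Na.
  by rewrite card_petal => <-; apply: eq_card.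
have sub f : ~~ well_sampled (with_samples f) h -> exists t, bad t f.
  rewrite /well_sampled negb_forall => /existsP[t nt]; exists t; apply: contra nt => /=.
  rewrite (cP t f) card_ord.
  have -> : #|[pred j | P t (f j)]| = sampled_petals (with_samples f) h t by [].
  rewrite Na -/D; move: (petals _ h t) (sampled_petals _ h t) => x c /andP[h1 h2].
  by apply/andP; split; rewrite -(leq_pmul2l a0); [move: h1 | move: h2]; rewrite !mulnDr; lia.
apply: leq_trans (_ : (\sum_t #|bad t|) * m <= _).
  rewrite leq_mul2r; apply/orP; right.
  apply: leq_trans (_ : #|\bigcup_t [set f | bad t f]| <= _).
    apply: subset_leq_card; apply/subsetP => f /sub[t bt].
    by apply/bigcupP; exists t => //; rewrite inE.
  elim/big_rec2: _ => [|t b B _ le]; first by rewrite cards0.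
  apply: leq_trans (leq_card_setU _ _) _; rewrite leq_add // cardsE //.
rewrite big_distrl /= -sum_nat_const; apply: leq_sum => t _.
by rewrite -[X in X ^ m](card_ord N); apply: sampling_deviation.
Qed.

Lemma sum_ill_degree :
  (\sum_f ill_degree (with_samples f)) * m
  <= #|V|.*2 * (#|T| * (g ^ 2 * N ^ m)).
Proof.
have [LU LS LI LA] := FL.
pose W f h := well_sampled (with_samples f) h.
have -> : \sum_f ill_degree (with_samples f) =
    \sum_(h | hub d L h) \sum_(f | ~~ W f h) size (L h).
  rewrite /ill_degree (exchange_big_dep (hub d L)) /= => [|f h _ /andP[] //].
  by apply: eq_bigr => h hh; apply: eq_bigl => f; rewrite hh.
apply: leq_trans (_ : \sum_h size (L h) * (#|T| * (g ^ 2 * N ^ m)) <= _); last first.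
  by rewrite -big_distrl leq_mul2r (sum_degree LU LS LI LA) orbT.
rewrite big_distrl /= big_mkcond; apply: leq_sum => h _; case: ifP => // hh.
have D0 : 0 < size (L h) by apply: leq_ltn_trans hh.
rewrite sum_nat_const mulnAC mulnC leq_mul2l; apply/orP; right; exact: card_ill.
Qed.

End HubSampling.

(** * Closeness with explicit constants *)

Section Closeness.
Variables (A d s l g m w : nat) (V : finType).
Notation S := (d.+1 ^ (s.*2 + l)).
Notation T := (piece_type S).
Notation K := (hub_class g m S (trunc_log 2 #|V|)).
Notation n := #|V|.
Notation ill_degree := (@ill_degree d s l g m V).
Notation label_count := (@label_count d s l g m V).
Notation mismatch := (@mismatch d s l g m V).
Notation B := (2 * S * d * A).
Hypothesis m_gt0 : 0 < m.
Hypothesis g_def : g = 8 * #|T| * B.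
Hypothesis g_gt0 : 0 < g.
Hypothesis w_def : w = 2 * #|{: option K * T}| * B.
Hypothesis w_gt0 : 0 < w.

(** [B] is [A] times the number of darts that one unmatched piece costs in [lost_darts]. *)
Definition good_inst (I : sampled_lists V m) :=
  (A * removed d s l (lists I) (cuts I) <= n) &&
  (B * ill_degree I <= n).

Definition close_counts (I J : sampled_lists V m) := forall c : option K * T,
  w * label_count I c <= w * label_count J c + 2 * n.

(** Each of four errors is at most [g * n]: the label counts by the choice of [w], the two ill
    degrees by [good_inst], and the degree term [2 * #|T| * B * 4 n] by the choice of [g]. *)
Lemma close_mismatch I J : forest_lists (lists I) -> forest_lists (lists J) ->
  good_inst I -> good_inst J -> close_counts I J ->
  B * mismatch I J <= 4 * g * n.
Proof.
move=> FI FJ /andP[_ iI] /andP[_ iJ] cl; rewrite /mismatch.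
have [IU IS II IA] := FI; have [JU JS JI JA] := FJ.
have sD := leq_add (sum_degree IU IS II IA) (sum_degree JU JS JI JA).
have D1 : B * \sum_t \sum_o (label_count I (o, t) - label_count J (o, t) : nat) <= n.
  have H : w * \sum_t \sum_o (label_count I (o, t) - label_count J (o, t) : nat) <=
      #|{: option K * T}| * (2 * n).
    rewrite exchange_big pair_big /= big_distrr -sum_nat_const; apply: leq_sum => -[o t] _ /=.
    by rewrite mulnBr leq_subLR; apply: cl.
  have L0 : 0 < 2 * #|{: option K * T}|.
    by move: w_gt0; rewrite w_def muln_gt0 => /andP[].
  by rewrite -(leq_pmul2l L0); move: H; rewrite w_def; lia.
have arith b t a x y e k : g = 8 * t * b -> b * a <= k -> b * x <= k -> b * y <= k ->
    e <= k.*2 + k.*2 -> b * (g * a + g * (x + y) + 2 * t * e) <= 4 * g * k.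
  move=> gE ha hx hy he; have h1 := leq_mul (leqnn g) (leq_add ha (leq_add hx hy)).
  have h2 : 2 * t * b * e <= g * k.
    by rewrite gE; have := leq_mul (leqnn (2 * t * b)) he; rewrite -!addnn; lia.
  by lia.
exact: arith.
Qed.

(** On each side, [n] for the removed darts and [4 n] for those at unmatched pieces. *)
Lemma good_close I J : forest_lists (lists I) -> forest_lists (lists J) ->
  good_inst I -> good_inst J -> close_counts I J -> close_counts J I ->
  exists2 f : V -> V, injective f &
    A * (#|[pred p : V * V | (p.2 \in lists I p.1) && (f p.2 \notin lists J (f p.1))]| +
         #|[pred p : V * V | (f p.2 \in lists J (f p.1)) && (p.2 \notin lists I p.1)]|) <= 10 * n.
Proof.
move=> FI FJ gI gJ cIJ cJI.
have [f injf [u [v [l1 l2 mu mv]]]] := @similarity d s l g m V I J FI FJ m_gt0.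
exists f => //.
have key x I' J' : g * x <= mismatch I' J' -> B * mismatch I' J' <= 4 * g * n -> B * x <= 4 * n.
  move=> h1 h2; rewrite -(leq_pmul2l g_gt0).
  by have := leq_trans (leq_mul (leqnn B) h1) h2; lia.
have k1 := key _ _ _ mu (close_mismatch FI FJ gI gJ cIJ).
have k2 := key _ _ _ mv (close_mismatch FJ FI gJ gI cJI).
case/andP: gI => r1 _; case/andP: gJ => r2 _.
have := leq_mul (leqnn A) (leq_add l1 l2); lia.
Qed.

End Closeness.

(** * Local computability *)

Section Computable.
Variables (R : realType) (n : nat).
Notation lists_of := ('I_n -> seq 'I_n).

(* Continuation-passing style: whatever is done with the value [F L], an
   algorithm can do it after at most [q] queries to [L]. *)
Definition computable (X : Type) (q : nat) (F : lists_of -> X) : Type :=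
  forall k : X -> algorithm n, {A : algorithm n | forall L : lists_of,
    (forall b, output_prob R L A b = output_prob R L (k (F L)) b) /\
    query_count L A <= q + query_count L (k (F L))}.

Lemma comp_ext X q (F G : lists_of -> X) : F =1 G -> computable q F -> computable q G.
Proof. by move=> FG H k; have [A HA] := H k; exists A => L; rewrite -FG. Qed.

Lemma comp_const X (x : X) : computable 0 (fun _ => x).
Proof. by move=> k; exists (k x). Qed.

Lemma comp_le X q q' (F : lists_of -> X) : q <= q' -> computable q F -> computable q' F.
Proof.
move=> qq H k; have [A HA] := H k; exists A => L; have [h1 h2] := HA L; split=> //.
by apply: leq_trans h2 _; rewrite leq_add2r.
Qed.

Lemma comp_degree v : computable 1 (fun L => size (L v)).
Proof. by move=> k; exists (DegreeQuery v k). Qed.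

Lemma comp_neighbor v i : computable 1 (fun L => onth (L v) i).
Proof. by move=> k; exists (NeighborQuery v i k). Qed.

(** [P] records what holds of [F L] for every input, such as a length at most [d]; the cost bound
    for [G x] is required for such [x] only. *)
Lemma comp_bind X Y q1 q2 (P : pred X) (F : lists_of -> X) (G : X -> lists_of -> Y) :
  computable q1 F -> (forall L, P (F L)) -> (forall x, P x -> computable q2 (G x)) ->
  computable (q1 + q2) (fun L => G (F L) L).
Proof.
move=> HF PF HG k.
have HG' x : {A : algorithm n | P x -> forall L,
    (forall b, output_prob R L A b = output_prob R L (k (G x L)) b) /\
    query_count L A <= q2 + query_count L (k (G x L))}.
  have [px|npx] := boolP (P x); first by have [A HA] := HG x px k; exists A.
  (* Never reached, since [F L] satisfies [P]. *)
  by exists (Output _ true).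
have [A HA] := HF (fun x => sval (HG' x)); exists A => L.
have [h1 h2] := HA L; have [h3 h4] := svalP (HG' (F L)) (PF L) L.
split=> [b|]; first by rewrite h1 h3.
by apply: leq_trans h2 _; rewrite -addnA leq_add2l.
Qed.

Lemma comp_app X Y q (F : lists_of -> X) (h : X -> Y) :
  computable q F -> computable q (fun L => h (F L)).
Proof.
move=> HF; rewrite -[q]addn0.
by apply: (comp_bind (P := predT) (G := fun x _ => h x) HF) => // x _; apply: comp_const.
Qed.

Lemma comp_seq (Y X : Type) q (r : seq Y) (F : Y -> lists_of -> X) :
  (forall y, computable q (F y)) -> computable (size r * q) (fun L => [seq F y L | y <- r]).
Proof.
move=> HF; elim: r => [|y r IH] /=; first exact: comp_const.
rewrite mulSn; apply: (comp_bind (P := predT) (G := fun x L => x :: [seq F y L | y <- r]) (HF y)) => // x _.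
exact: (comp_app (cons x)).
Qed.

Lemma comp_seq_le (Y X : Type) q b (r : seq Y) (F : Y -> lists_of -> X) :
  size r <= b -> (forall y, computable q (F y)) -> computable (b * q) (fun L => [seq F y L | y <- r]).
Proof. by move=> rb HF; apply: comp_le (comp_seq r HF); rewrite leq_mul2r rb orbT. Qed.

Lemma comp_filter (Y : Type) q b (r : seq Y) (F : Y -> lists_of -> bool) :
  size r <= b -> (forall y, computable q (F y)) -> computable (b * q) (fun L => [seq y <- r | F y L]).
Proof.
move=> rb HF; apply: (comp_ext (F := fun L => mask [seq F y L | y <- r] r)).
  by move=> L; rewrite filter_mask.
by apply: (comp_app (fun bs => mask bs r)); apply: comp_seq_le.
Qed.

(** * Query costs of pieces, classes and labels *)

Variables (d s l g m : nat) (z : pred 'I_n) (sm : 'I_m -> nat).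
Notation S := (d.+1 ^ (s.*2 + l)).

(** These costs are independent of [n]; in the query bound only the number of sampled vertices
    grows. *)
Definition lowN_cost := 1 + (d + d).
Fixpoint side_cost k := if k is k'.+1 then lowN_cost + d * side_cost k' else 0.
Definition core_cost := lowN_cost + (side_cost s + side_cost s).
Definition coreN_cost := lowN_cost + d * (side_cost s + side_cost s).
Fixpoint run_cost k := if k is k'.+1 then coreN_cost + (coreN_cost + d * run_cost k') else 0.
Definition cut_cost := coreN_cost + (coreN_cost + (run_cost l + run_cost l)).
Definition pieceN_cost := lowN_cost + d * (core_cost + cut_cost).
Fixpoint ball_cost k := if k is k'.+1 then pieceN_cost + d * ball_cost k' else 0.
Definition piece_cost := ball_cost (s.*2 + l).
Definition attach_cost := S * lowN_cost.
Definition type_cost := S * pieceN_cost + attach_cost.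
Definition petal_cost := 1 + (1 + (piece_cost + (attach_cost + type_cost))).
Definition class_cost := 1 + m * petal_cost.
Definition label_cost := 1 + (piece_cost + (attach_cost + (type_cost + class_cost))).

Lemma comp_hub v : computable 1 (fun L => hub d L v).
Proof. exact: (comp_app (fun k => d < k) (comp_degree v)). Qed.

(** The first [d] positions are probed; those past the end answer [None] and are dropped. *)
Lemma comp_take v : computable d (fun L => take d (L v)).
Proof.
apply: (comp_ext (F := fun L => pmap id [seq onth (L v) i | i <- iota 0 d])).
  move=> L; elim: (d) (L v) => [|k IH] [|x r] //=; rewrite ?take0 //.
    by elim: (iota 1 k) => //= i q ->; case: i.
  congr cons; rewrite -IH; congr pmap.
  by rewrite (iotaDl 1 0) -map_comp; apply: eq_map.
apply: comp_app; rewrite -[X in computable X]muln1.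
by apply: comp_seq_le => [|i]; [rewrite size_iota | apply: comp_neighbor].
Qed.

Lemma comp_take_filter v (b : bool) :
  computable (d + d) (fun L => [seq u <- take d (L v) | hub d L u == b]).
Proof.
apply: (comp_bind (P := fun r => size r <= d) (G := fun r L => [seq u <- r | hub d L u == b])
  (comp_take v)) => [L|r rd]; first by rewrite size_take_min geq_minl.
rewrite -[X in computable X]muln1; apply: comp_filter rd _ => u.
exact: (comp_app (fun c => c == b) (comp_hub u)).
Qed.

Lemma comp_lowN v : computable lowN_cost (fun L => lowN d L v).
Proof.
apply: (comp_bind (P := predT) (F := fun L => hub d L v) (G := fun c L =>
  if c then [::] else [seq u <- take d (L v) | ~~ hub d L u]) (comp_hub v)) => // -[] _.
  by apply: comp_le (comp_const _).
apply: comp_ext (comp_take_filter v false) => L; apply: eq_filter => u.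
by case: (hub d L u).
Qed.

Lemma comp_hubN v : computable lowN_cost (fun L => hubN d L v).
Proof.
apply: (comp_bind (P := predT) (F := fun L => hub d L v) (G := fun c L =>
  if c then [::] else [seq u <- take d (L v) | hub d L u]) (comp_hub v)) => // -[] _.
  by apply: comp_le (comp_const _).
apply: comp_ext (comp_take_filter v true) => L; apply: eq_filter => u.
by case: (hub d L u).
Qed.

Lemma comp_side_size k v u : computable (side_cost k) (fun L => side_size d s L k v u).
Proof.
elim: k v u => [|k IH] v u; first exact: comp_const.
apply: (comp_bind (P := fun r => size r <= d) (F := fun L => lowN d L v) (G := fun r L =>
  (\sum_(w <- r | w != u) side_size d s L k w v).+1) (comp_lowN v)) => [L|r rd].
  exact: size_lowN.
apply: comp_app.
apply: (comp_ext (F := fun L => sumn [seq side_size d s L k w v | w <- [seq w <- r | w != u]])).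
  by move=> L; rewrite sumnE big_map big_filter.
apply: comp_app; apply: comp_seq_le => [|w]; last exact: IH.
by rewrite size_filter (leq_trans (count_size _ _)).
Qed.

Lemma comp_and q1 q2 (F G : lists_of -> bool) :
  computable q1 F -> computable q2 G -> computable (q1 + q2) (fun L => F L && G L).
Proof.
move=> HF HG.
apply: (comp_bind (P := predT) (G := fun b L => b && G L) HF) => // b _.
exact: (comp_app (andb b)).
Qed.

Lemma comp_or q1 q2 (F G : lists_of -> bool) :
  computable q1 F -> computable q2 G -> computable (q1 + q2) (fun L => F L || G L).
Proof.
move=> HF HG.
apply: (comp_bind (P := predT) (G := fun b L => b || G L) HF) => // b _.
exact: (comp_app (orb b)).
Qed.

Lemma comp_big v u : computable (side_cost s) (fun L => big d s L v u).
Proof. exact: (comp_app (fun k => s < k) (comp_side_size s v u)). Qed.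

Lemma comp_core v u : computable core_cost (fun L => core d s L v u).
Proof.
apply: comp_and; first exact: (comp_app (fun r => u \in r) (comp_lowN v)).
by apply: comp_and; apply: comp_big.
Qed.

Lemma comp_coreN v : computable coreN_cost (fun L => coreN d s L v).
Proof.
apply: (comp_bind (P := fun r => size r <= d) (F := fun L => lowN d L v) (G := fun r L =>
  [seq u <- r | big d s L v u && big d s L u v]) (comp_lowN v)) => [L|r rd].
  exact: size_lowN.
by apply: comp_filter => // u; apply: comp_and; apply: comp_big.
Qed.

Lemma size_coreN_le L (v : 'I_n) : size (coreN d s L v) <= d.
Proof. by rewrite size_filter (leq_trans (count_size _ _)) ?size_lowN. Qed.

Lemma comp_branch v : computable coreN_cost (fun L => branch d s L v).
Proof. exact: (comp_app (fun r => 2 < size r) (comp_coreN v)). Qed.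

Lemma comp_long_run k x y : computable (run_cost k) (fun L => long_run d s L z k x y).
Proof.
elim: k x y => [|k IH] x y; first exact: comp_const.
apply: (comp_app (andb (~~ z y))); apply: comp_and.
  exact: (comp_app negb (comp_branch y)).
apply: (comp_bind (P := fun r => size r <= d) (F := fun L => coreN d s L y) (G := fun r L =>
  has (fun w => (w != x) && long_run d s L z k y w) r) (comp_coreN y)) => [L|r rd].
  exact: size_coreN_le.
apply: (comp_ext (F := fun L => has id [seq (w != x) && long_run d s L z k y w | w <- r])).
  by move=> L; rewrite has_map.
by apply: comp_app; apply: comp_seq_le => // w; apply: comp_app.
Qed.

Lemma comp_cut x y : computable cut_cost (fun L => cut d s l L z x y).
Proof.
(* The random cut belongs to the algorithm, so testing [z] takes no query. *)
apply: (comp_app (orb (z x))); apply: (comp_app (orb (z y))).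
by do 3?[apply: comp_or]; do ?[apply: comp_branch | apply: comp_long_run].
Qed.

Lemma comp_pieceN x : computable pieceN_cost (fun L => pieceN d s l L z x).
Proof.
apply: (comp_bind (P := fun r => size r <= d) (F := fun L => lowN d L x) (G := fun r L =>
  [seq y <- r | core d s L x y ==> ~~ cut d s l L z x y]) (comp_lowN x)) => [L|r rd].
  exact: size_lowN.
apply: comp_filter => // y.
apply: (comp_ext (F := fun L => ~~ (core d s L x y && cut d s l L z x y))).
  by move=> L; rewrite negb_and implybE.
by apply: (comp_app negb); apply: comp_and; [apply: comp_core | apply: comp_cut].
Qed.

Lemma comp_ball k v : computable (ball_cost k) (fun L => ball d s l L z k v).
Proof.
elim: k v => [|k IH] v; first exact: comp_const.
apply: (comp_bind (P := fun r => size r <= d) (F := fun L => pieceN d s l L z v) (G := fun r L =>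
  v |: \bigcup_(w <- r) ball d s l L z k w) (comp_pieceN v)) => [L|r rd].
  exact: size_pieceN.
apply: (comp_ext (F := fun L => v |: \bigcup_(A <- [seq ball d s l L z k w | w <- r]) A)).
  by move=> L; rewrite big_map.
by apply: (comp_app (fun As => v |: \bigcup_(A <- As) A)); apply: comp_seq_le.
Qed.

Lemma comp_attach (A : {set 'I_n}) : #|A| <= S -> computable attach_cost (fun L => attach d L A).
Proof.
move=> AS; apply: (comp_app (fun es => if es is [:: e] then Some e else None)).
apply: (comp_app flatten).
apply: (comp_ext (F := fun L => [seq [seq (xr.1, h) | h <- xr.2] | xr <- zip (enum A) [seq hubN d L x | x <- enum A]])).
  by move=> L; elim: (enum A) => //= x q ->.
apply: (comp_app (fun rs => [seq [seq (xr.1, h) | h <- xr.2] | xr <- zip (enum A) rs])).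
by apply: comp_seq_le => [|x]; [rewrite -cardE | apply: comp_hubN].
Qed.

Notation inst L := (SampledLists L z sm).

Lemma comp_type (A : {set 'I_n}) : #|A| <= S ->
  computable type_cost (fun L => type_of d s l (inst L) A).
Proof.
move=> AS.
pose mk (Ns : seq (seq 'I_n)) (e : option ('I_n * 'I_n)) : piece_type S :=
 ([ffun ij : 'I_S * 'I_S =>
      if onth (enum A) ij.1 is Some x then
        if onth (enum A) ij.2 is Some y then y \in nth [::] Ns ij.1 else false
      else false],
   inord #|A|,
   [ffun i : 'I_S => if e is Some (x, _) then onth (enum A) i == Some x else false]).
apply: (comp_ext (F := fun L => mk [seq pieceN d s l L z x | x <- enum A] (attach d L A))).
  move=> L; rewrite /mk /type_of /=; congr (_, _, _); apply/ffunP => -[i j]; rewrite !ffunE /=.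
  case E: (onth (enum A) i) => [x|] //; case: (onth (enum A) j) => [y|] //.
  by rewrite (nth_map x) ?(onth_nth x _ _ _ E) // -onthTE E.
apply: (comp_bind (P := predT) (F := fun L => [seq pieceN d s l L z x | x <- enum A])
  (G := fun Ns L => mk Ns (attach d L A))) => // [|Ns _].
  by apply: comp_seq_le => [|x]; [rewrite -cardE | apply: comp_pieceN].
by apply: (comp_app (mk Ns)); apply: comp_attach.
Qed.

Lemma comp_petal h i : computable petal_cost (fun L => petal d s l (inst L) h i).
Proof.
apply: (comp_bind (P := predT) (F := fun L => onth (L h) i) (G := fun o L =>
  if o is Some u then
    if ~~ hub d L u && (attach d L (piece d s l L z u) == Some (u, h))
    then Some (type_of d s l (inst L) (piece d s l L z u)) else None
  else None) (comp_neighbor h i)) => // -[u|] _; last first.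
  by apply: comp_le (comp_const _).
apply: (comp_bind (P := predT) (F := fun L => hub d L u) (G := fun b L =>
    if ~~ b && (attach d L (piece d s l L z u) == Some (u, h))
    then Some (type_of d s l (inst L) (piece d s l L z u)) else None) (comp_hub u)) => // b _.
apply: (comp_bind (P := fun A : {set 'I_n} => #|A| <= S) (F := fun L => piece d s l L z u) (G := fun A L =>
    if ~~ b && (attach d L A == Some (u, h))
    then Some (type_of d s l (inst L) A) else None)) => [|L|A AS].
- exact: comp_ball.
- exact: card_piece.
apply: (comp_bind (P := predT) (F := fun L => attach d L A) (G := fun e L =>
    if ~~ b && (e == Some (u, h))
    then Some (type_of d s l (inst L) A) else None)) => // [|e _].
  exact: comp_attach.
case: (~~ b && (e == Some (u, h))); last by apply: comp_le (comp_const _).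
by apply: (comp_app Some); apply: comp_type.
Qed.

(** Although the degree of a hub is unbounded, one degree query and [m] inspected positions
    determine its class. *)
Lemma comp_class h : computable class_cost (fun L => class_of d s l g (inst L) h).
Proof.
pose cnt (ps : seq (option (piece_type S))) t := #|[pred j : 'I_m | nth None ps j == Some t]|.
pose mk (D : nat) ps : hub_class g m S (trunc_log 2 #|'I_n|) :=
  (inord (trunc_log 2 D), inord (D * g %/ 2 ^ trunc_log 2 D), [ffun t => inord (cnt ps t)]).
apply: (comp_ext (F := fun L => mk (size (L h))
   [seq petal d s l (inst L) h (sm j %% size (L h)) | j <- enum 'I_m])).
  move=> L; rewrite /mk /class_of; congr (_, _, _); apply/ffunP => t; rewrite !ffunE; congr inord.
  apply: eq_card => j; rewrite !inE (nth_map j) ?nth_ord_enum //.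
  by rewrite size_enum_ord.
apply: (comp_bind (P := predT) (F := fun L => size (L h)) (G := fun D L => mk D
   [seq petal d s l (inst L) h (sm j %% D) | j <- enum 'I_m]) (comp_degree h)) => // D _.
apply: (comp_app (mk D)); apply: comp_seq_le => [|j]; first by rewrite size_enum_ord.
exact: comp_petal.
Qed.

Lemma comp_label v : computable label_cost (fun L => label d s l g (inst L) v).
Proof.
pose rp (A : {set 'I_n}) (e : option ('I_n * 'I_n)) := if e is Some (x, _) then x else head v (enum A).
apply: (comp_bind (P := predT) (F := fun L => hub d L v) (G := fun b L =>
  if ~~ b && (rp (piece d s l L z v) (attach d L (piece d s l L z v)) == v) then
    Some (omap (fun e => class_of d s l g (inst L) e.2) (attach d L (piece d s l L z v)),
          type_of d s l (inst L) (piece d s l L z v))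
  else None) (comp_hub v)) => // b _.
apply: (comp_bind (P := fun A : {set 'I_n} => #|A| <= S) (F := fun L => piece d s l L z v) (G := fun A L =>
  if ~~ b && (rp A (attach d L A) == v) then
    Some (omap (fun e => class_of d s l g (inst L) e.2) (attach d L A), type_of d s l (inst L) A)
  else None)) => [|L|A AS].
- exact: comp_ball.
- exact: card_piece.
apply: (comp_bind (P := predT) (F := fun L => attach d L A) (G := fun e L =>
  if ~~ b && (rp A e == v) then
    Some (omap (fun e => class_of d s l g (inst L) e.2) e, type_of d s l (inst L) A)
  else None)) => // [|e _].
  exact: comp_attach.
case: (~~ b && (rp A e == v)); last by apply: comp_le (comp_const _).
apply: (comp_app Some).
apply: (comp_bind (P := predT) (F := fun L => type_of d s l (inst L) A) (G := fun t L =>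
  (omap (fun e => class_of d s l g (inst L) e.2) e, t))) => // [|t _].
  exact: comp_type.
case: e => [e|]; last exact: (comp_le (leq0n _) (comp_const (None, t))).
by apply: (comp_app (fun k => (Some k, t))); apply: comp_class.
Qed.

End Computable.

(** * The tester *)

Lemma card_fst (F1 F2 : finType) (Q : pred F1) :
  #|[pred p : F1 * F2 | Q p.1]| = #|Q| * #|F2|.
Proof. by rewrite -cardX; apply: eq_card => -[x y]; rewrite !inE andbT. Qed.

Lemma card_fibers (F1 F2 : finType) (Q : F1 -> F2 -> bool) q :
  (forall x, #|[pred y | Q x y]| * q <= #|F2|) ->
  #|[pred p : F1 * F2 | Q p.1 p.2]| * q <= #|F1| * #|F2|.
Proof.
move=> H; rewrite (card_partition_by _ fst) big_distrl /= -sum_nat_const.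
apply: leq_sum => x _; apply: leq_trans (H x); rewrite leq_mul2r; apply/orP; right.
rewrite -(card_imset (mem [pred y | Q x y]) (f := fun y => (x, y))) => [|y y' [] //].
apply: subset_leq_card; apply/subsetP => -[x' y]; rewrite !inE /= => /andP[Qxy /eqP xx].
by rewrite xx in Qxy *; apply/imsetP; exists y.
Qed.

Lemma random_algorithm (R : realType) n (F : finType) (k : F -> algorithm n) : 0 < #|F| ->
  {A : algorithm n | forall L,
    (forall b, output_prob R L A b = ((\sum_f output_prob R L (k f) b) / #|F|%:R)%R) /\
    (forall q, (forall f, query_count L (k f) <= q) -> query_count L A <= q)}.
Proof.
case E: #|F| => [//|M] _; exists (Random (fun i : 'I_M.+1 => k (enum_val (cast_ord (esym E) i)))).
move=> L; split=> [b|q kq] /=; last by apply/bigmax_leqP => i _.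
congr (_ / _)%R; rewrite [RHS](reindex (fun i : 'I_M.+1 => enum_val (cast_ord (esym E) i))) //.
apply: onW_bij; exists (fun f => cast_ord E (enum_rank f)) => [i|f].
  by rewrite enum_valK cast_ordKV.
by rewrite cast_ordK enum_rankK.
Qed.

Lemma adj_list_forest n (G : graph n) (L : adj_list G) : forest G -> forest_lists L.
Proof.
move=> FG; split=> [v|v w|v|c sc].
- exact: nbrs_uniq.
- by rewrite !mem_nbrs adj_sym.
- by rewrite mem_nbrs adj_irr.
- by move=> cyc; apply: (FG c sc); apply: sub_ucycle cyc => x y; rewrite mem_nbrs.
Qed.

Lemma pullback_sym n (H : graph n) (f : 'I_n -> 'I_n) : symmetric (fun x y => H (f x) (f y)).
Proof. by move=> x y; apply: adj_sym. Qed.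

Lemma pullback_irr n (H : graph n) (f : 'I_n -> 'I_n) : irreflexive (fun x y => H (f x) (f y)).
Proof. by move=> x; apply: adj_irr. Qed.

(** For injective [f], an isomorphic copy of [H] laid over [G], to which the edit distance is
    measured. *)
Definition pullback n (H : graph n) f := Graph (@pullback_sym n H f) (@pullback_irr n H f).

Lemma pullback_satisfies (P : graph_property) n (H : graph n) f :
  injective f -> P n H -> P n (pullback H f).
Proof.
move=> injf; apply: satisfies_iso; exists (finv f).
  exact: injF_bij (finv_inj injf).
by move=> x y /=; rewrite !f_finv.
Qed.

Lemma mem_edges n (G : graph n) e :
  reflect (exists x y, G x y /\ e = [set x; y]) (e \in edges G).
Proof.
apply: (iffP imset2P) => [[x y _ Gxy ->]|[x [y [Gxy ->]]]]; first by exists x, y.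
by exists x y.
Qed.

Lemma card_edges_diff n (G H : graph n) :
  #|edges G :\: edges H| <= #|[pred p : 'I_n * 'I_n | G p.1 p.2 && ~~ H p.1 p.2]|.
Proof.
apply: leq_trans (leq_imset_card (fun p : 'I_n * 'I_n => [set p.1; p.2]) _).
apply: subset_leq_card; apply/subsetP => e; rewrite inE => /andP[nH /mem_edges[x [y [Gxy eE]]]].
apply/imsetP; exists (x, y) => //; rewrite inE /= Gxy /=.
by apply: contra nH => Hxy; apply/mem_edges; exists x, y.
Qed.

Lemma edit_distance_le n (G H : graph n) :
  edit_distance G H <= #|[pred p : 'I_n * 'I_n | G p.1 p.2 && ~~ H p.1 p.2]| +
    #|[pred p : 'I_n * 'I_n | H p.1 p.2 && ~~ G p.1 p.2]|.
Proof.
apply: leq_trans (leq_card_setU _ _) _; by apply: leq_add; apply: card_edges_diff.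
Qed.

Section Tester.
Variables (R : realType) (P : graph_property) (A d s M g m : nat).
Notation l := (M * M).
Notation S := (d.+1 ^ (s.*2 + l)).
Notation T := (piece_type S).
Notation B := (2 * S * d * A).
Hypothesis A_gt0 : 0 < A.
Hypothesis d_def : d.+1 = 48 * A.
Hypothesis s_def : s.+1 = 24 * A.
Hypothesis M_def : M.+1 = 160 * A.
Hypothesis g_def : g = 8 * #|T| * B.
Hypothesis m_def : m = 20 * B * #|T| * g ^ 2.

Let T_gt0 : 0 < #|T|.
Proof. by apply/card_gt0P; exists ([ffun=> false], ord0, [ffun=> false]). Qed.
Let B_gt0 : 0 < B.
Proof. by rewrite !muln_gt0 expn_gt0 A_gt0 /= andbT; lia. Qed.
Let g_gt0 : 0 < g.
Proof. by rewrite g_def; move: B_gt0 T_gt0; move: B #|T| => b t; rewrite !muln_gt0 => -> ->. Qed.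
Let m_gt0 : 0 < m.
Proof.
rewrite m_def; move: B_gt0 T_gt0 g_gt0; move: B #|T| => b t.
by rewrite !muln_gt0 => -> -> ->.
Qed.

Section Size.
Variable n : nat.
Notation K := (hub_class g m S (trunc_log 2 #|'I_n|)).
Notation Lam := (option K * T)%type.
Definition tester_precision := 2 * #|{: Lam}| * B.
Notation w := tester_precision.
Definition sample_size := 10 * #|{: Lam}| * w ^ 2.
Notation t := sample_size.

(** The factorial is divisible by every positive degree, so the reduced samples are uniform at all
    hubs. *)
Definition randomness : finType :=
  ({ffun 'I_n -> 'I_M.+1} * {ffun 'I_m -> 'I_(n`!)} * {ffun 'I_t -> 'I_n})%type.

Definition seeded (L : 'I_n -> seq 'I_n) (a : {ffun 'I_n -> 'I_M.+1} * {ffun 'I_m -> 'I_(n`!)}) :=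
  with_samples L (cut_of a.1) a.2.

Notation label := (@label d s l g m 'I_n).
Notation label_count := (@label_count d s l g m 'I_n).
Notation good_inst := (@good_inst A d s l g m 'I_n).

Definition fits (labs : seq (option Lam)) (I : sampled_lists 'I_n m) :=
  [forall c, (w * t * label_count I c <= w * count_mem (Some c) labs * n + t * n) &&
             (w * count_mem (Some c) labs * n <= w * t * label_count I c + t * n)].

(** A classical decision over all forests, as the model charges for queries only. With the seed [a]
    existential, [G] and its own seed witness acceptance, while [rejects_far] works for any seed
    that meets [good_inst]. *)
Definition accepts (labs : seq (option Lam)) : bool :=
  `[< exists (H : graph n) (L : adj_list H) a,
      [/\ P n H, forest H, good_inst (seeded L a) & fits labs (seeded L a)] >].

Definition sample_labels L (r : randomness) := [seq label (seeded L r.1) v | v <- [seq r.2 j | j <- enum 'I_t]].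

Lemma Lam_gt0 : 0 < #|{: Lam}|.
Proof.
have /card_gt0P[x _] := T_gt0.
by apply/card_gt0P; exists (None, x).
Qed.

Lemma w_gt0 : 0 < w.
Proof. by rewrite /w muln_gt0 B_gt0 andbT muln_gt0 Lam_gt0. Qed.

Lemma t_gt0 : 0 < t.
Proof. by rewrite /t muln_gt0 expn_gt0 w_gt0 andbT muln_gt0 Lam_gt0. Qed.

Lemma tester_algorithm : 0 < n -> {Alg : algorithm n | forall L,
  (forall b, output_prob R L Alg b =
     ((\sum_(r : randomness) (accepts (sample_labels L r) == b)%:R) / #|randomness|%:R)%R) /\
  query_count L Alg <= t * label_cost d s l m}.
Proof.
move=> n0.
have run (r : randomness) : {Alg : algorithm n | forall L,
    (forall b, output_prob R L Alg b = ((accepts (sample_labels L r) == b)%:R)%R) /\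
    query_count L Alg <= t * label_cost d s l m}.
  have H := @comp_seq R n 'I_n _ (label_cost d s l m) [seq r.2 j | j <- enum 'I_t]
    (fun v L => label (seeded L r.1) v)
    (fun v => @comp_label R n d s l g m (cut_of r.1.1) (fun j => r.1.2 j : nat) v).
  have [Alg HA] := H (fun labs => Output n (accepts labs)); exists Alg => L.
  have [h1 h2] := HA L; split=> [b|]; first by rewrite h1.
  by apply: leq_trans h2 _; rewrite addn0 size_map size_enum_ord.
have r0 : 0 < #|randomness|.
  apply/card_gt0P; exists ([ffun=> ord0], [ffun=> Ordinal (fact_gt0 n)], [ffun=> Ordinal n0]).
  by [].
have [Alg HA] := random_algorithm R (fun r => sval (run r)) r0.
exists Alg => L; have [h1 h2] := HA L; split=> [b|].
  by rewrite h1; congr (_ / _)%R; apply: eq_bigr => r _; have [-> _] := svalP (run r) L.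
by apply: h2 => r; have [_] := svalP (run r) L.
Qed.

Definition representative (L : 'I_n -> seq 'I_n) (r : randomness) :=
  good_inst (seeded L r.1) && fits (sample_labels L r) (seeded L r.1).

Lemma count_sample_labels L r c : count_mem (Some c) (sample_labels L r) =
  #|[pred j | label (seeded L r.1) (r.2 j) == Some c]|.
Proof.
transitivity (\sum_(j < t) (label (seeded L r.1) (r.2 j) == Some c : nat)).
  rewrite count_map count_map -sum1_count big_mkcond big_enum /=.
  by apply: eq_bigr => j _; case: ifP.
by rewrite -(card_sum_nat (fun j => label (seeded L r.1) (r.2 j) == Some c)); apply: eq_card.
Qed.

(** * Probability of an unrepresentative seed *)

Section Deviations.
Variable L : 'I_n -> seq 'I_n.
Hypothesis FL : forest_lists L.
Hypothesis n_gt0 : 0 < n.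
Let L_uniq : forall v, uniq (L v). Proof. by case: FL. Qed.
Let L_sym : forall v w, (w \in L v) = (v \in L w). Proof. by case: FL. Qed.
Let L_irr : forall v, v \notin L v. Proof. by case: FL. Qed.
Let L_acyclic : forall c : seq 'I_n, 2 < size c -> ~ ucycle (fun x y => y \in L x) c.
Proof. by case: FL. Qed.

Definition cut_loss (f : {ffun 'I_n -> 'I_M.+1}) := 4 * #|cut_of f| +
  2 * #|[pred p : 'I_n * 'I_n | core d s L p.1 p.2 && long_run d s L (cut_of f) l p.1 p.2]|.

(** Of the budget [n], hubs take [6 A * 2 n / (48 A) = n/4] and branch vertices
    [2 A * 3 n / (24 A) = n/4], so [n/2] remains for [cut_loss]. *)
Lemma few_cuts f : 2 * A * cut_loss f <= n -> A * removed d s l L (cut_of f) <= n.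
Proof.
have := removed_le d s l (cut_of f) L_uniq L_sym L_irr L_acyclic.
have := card_hubs d L_uniq L_sym L_irr L_acyclic.
have := sum_branch d s L_uniq L_sym L_irr L_acyclic.
rewrite card_ord /cut_loss d_def s_def.
move: #|hub d L| (\sum_(v | branch d s L v) _) #|cut_of f| #|[pred p : _ * _ | _]| (removed _ _ _ _ _) => h b c e r.
move=> hb hh hr hX; have := leq_mul (leqnn A) hr; rewrite -addnn in hh.
by lia.
Qed.

(** The expected [cut_loss] is at most [4 n / (M + 1)] for cut vertices plus [2 * 2 n / (M + 1)] for
    long runs, in all [n / (20 A)]; Markov's inequality gives 1/10. *)
Lemma cut_loss_deviation : #|[pred f | n < 2 * A * cut_loss f]| * 10 <= M.+1 ^ n.
Proof.
have M0 : 0 < M by lia.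
have c1 := sum_card_cut 'I_n M; have c2 := sum_long_runs d s L_uniq L_sym L_irr L_acyclic M M0.
have := markov_card cut_loss (2 * A) n.
rewrite /cut_loss big_split -!big_distrr /=.
rewrite !card_ord in c1 c2.
have arith a b e N M' : M' = 160 * A -> a * M' = n * N -> b * M' <= n.*2 * N ->
    e * n <= 2 * A * (4 * a + 2 * b) -> e * 10 <= N.
  move=> -> h1 h2 h3; rewrite -(leq_pmul2r n_gt0); rewrite -addnn in h2.
  by lia.
exact: arith M_def c1 c2.
Qed.

(** The expected [B * ill_degree] is at most [2 n * B * #|T| * g ^ 2 / m = n/10], which is how [m]
    was chosen. *)
Lemma ill_degree_deviation (f : {ffun 'I_n -> 'I_M.+1}) :
  #|[pred x : {ffun 'I_m -> 'I_(n`!)} | n < B * ill_degree d s l g (seeded L (f, x))]| * 10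
  <= #|{ffun 'I_m -> 'I_(n`!)}|.
Proof.
have N_div D : 0 < D <= #|'I_n| -> D %| n`!.
  by rewrite card_ord => /andP[D0 Dn]; apply: dvdn_fact; rewrite D0.
have := sum_ill_degree d s l g m (cut_of f) FL (fact_gt0 n) N_div.
have := markov_card (fun x => ill_degree d s l g (seeded L (f, x))) B n.
rewrite card_ffun !card_ord.
have arith a e N k : a * m <= n.*2 * (#|T| * (g ^ 2 * N)) -> e * n <= B * a -> k = 10 -> e * k <= N.
  move=> h1 h2 ->; have h3 := leq_mul h2 (leqnn m).
  have h4 := leq_mul (leqnn B) h1.
  have h5 : e * n * m <= B * (n.*2 * (#|T| * (g ^ 2 * N))) by lia.
  have p0 : 0 < n * (2 * B * #|T| * g ^ 2).
    move: m_gt0; rewrite m_def muln_gt0 => /andP[h6 h7].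
    by rewrite muln_gt0 n_gt0 muln_gt0 h7 andbT; lia.
  rewrite -(leq_pmul2l p0); move: h5; rewrite [X in e * n * X]m_def -addnn.
  by move: (g ^ 2) B #|T| => x y z; lia.
by move=> h1 h2; apply: arith h2 h1 erefl.
Qed.

(** A union bound over the labels, each of which deviates with probability at most [w ^ 2 / t]. *)
Lemma fits_deviation a :
  #|[pred y : {ffun 'I_t -> 'I_n} | ~~ fits (sample_labels L (a, y)) (seeded L a)]| * 10
  <= #|{ffun 'I_t -> 'I_n}|.
Proof.
pose Q (c : Lam) : pred 'I_n := fun v => label (seeded L a) v == Some c.
pose bad c := [pred y : {ffun 'I_t -> 'I_n} | let k := #|[pred j | Q c (y j)]| in
     ~~ ((w * t * #|Q c| <= w * k * #|'I_n| + t * #|'I_n|) &&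
         (w * k * #|'I_n| <= w * t * #|Q c| + t * #|'I_n|))].
have sub y : ~~ fits (sample_labels L (a, y)) (seeded L a) -> exists c, bad c y.
  rewrite /fits negb_forall => /existsP[c nc]; exists c; apply: contra nc.
  rewrite count_sample_labels /= [in X in X -> _](card_ord n).
  by rewrite (_ : label_count _ c = #|Q c|) //; apply: eq_card.
have H : #|[pred y : {ffun 'I_t -> 'I_n} | ~~ fits (sample_labels L (a, y)) (seeded L a)]| * t <=
    #|{: Lam}| * (w ^ 2 * #|'I_n| ^ t).
  apply: leq_trans (_ : (\sum_c #|bad c|) * t <= _).
    rewrite leq_mul2r; apply/orP; right.
    apply: leq_trans (_ : #|\bigcup_c [set y | bad c y]| <= _).
      apply: subset_leq_card; apply/subsetP => y /sub[c bc].
      by apply/bigcupP; exists c => //; rewrite inE.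
    elim/big_rec2: _ => [|c b0 B0 _ le]; first by rewrite cards0.
    by apply: leq_trans (leq_card_setU _ _) _; rewrite leq_add // cardsE.
  rewrite big_distrl /= -sum_nat_const; apply: leq_sum => c _.
  exact: sampling_deviation.
have E : #|{ffun 'I_t -> 'I_n}| = #|'I_n| ^ t by rewrite card_ffun; congr (_ ^ _); apply: card_ord.
rewrite E; have p0 : 0 < #|{: Lam}| * w ^ 2 by rewrite muln_gt0 Lam_gt0 expn_gt0 w_gt0.
have arith a' x y N k : a' * k <= x * (y * N) -> k = 10 * x * y -> 0 < x * y -> a' * 10 <= N.
  by move=> h1 h2 h3; rewrite -(leq_pmul2l h3); move: h1; rewrite h2; lia.
exact: arith H _ p0.
Qed.

(** Three failures of probability at most 1/10 each; the remaining 7/10 exceed 2/3. *)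
Lemma card_unrepresentative : #|[pred r | ~~ representative L r]| * 10 <= 3 * #|randomness|.
Proof.
pose E1 := [pred r : randomness | n < 2 * A * cut_loss r.1.1].
pose E2 := [pred r : randomness | n < B * ill_degree d s l g (seeded L r.1)].
pose E3 := [pred r : randomness | ~~ fits (sample_labels L r) (seeded L r.1)].
have le : #|[pred r | ~~ representative L r]| <= #|E1| + (#|E2| + #|E3|).
  apply: leq_trans (card_predU_le (B := E1) (C := [predU E2 & E3]) _) _; last first.
    by rewrite leq_add2l; apply: card_predU_le.
  move=> r nr; have : ~~ representative L r := nr.
  rewrite negb_and /good_inst negb_and -!ltnNge => /orP[/orP[h|h]|h].
  - apply/orP; left; rewrite /E1 /= ltnNge; apply/negP => /few_cuts h'.
    by move: h; rewrite card_ord ltnNge h'.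
  - by apply/orP; right; apply/orP; left; move: h; rewrite card_ord.
  - by apply/orP; right; apply/orP; right.
have cR : #|randomness| = #|{ffun 'I_n -> 'I_M.+1}| * #|{ffun 'I_m -> 'I_(n`!)}| * #|{ffun 'I_t -> 'I_n}|.
  by rewrite !card_prod.
have h1 : #|E1| * 10 <= #|randomness|.
  have -> : #|E1| = #|[pred f | n < 2 * A * cut_loss f]| * #|{ffun 'I_m -> 'I_(n`!)}| * #|{ffun 'I_t -> 'I_n}|.
    by rewrite -card_fst -card_fst; apply: eq_card.
  have arith a b c e : a * 10 <= e -> a * b * c * 10 <= e * b * c.
    by move=> h; have := leq_mul h (leqnn (b * c)); lia.
  rewrite cR; apply: arith; apply: leq_trans cut_loss_deviation _.
  by rewrite card_ffun !card_ord.
have h2 : #|E2| * 10 <= #|randomness|.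
  have -> : #|E2| = #|[pred a : {ffun 'I_n -> 'I_M.+1} * {ffun 'I_m -> 'I_(n`!)} |
      n < B * ill_degree d s l g (seeded L (a.1, a.2))]| * #|{ffun 'I_t -> 'I_n}|.
    by rewrite -card_fst; apply: eq_card => -[[]].
  rewrite cR mulnAC leq_mul2r; apply/orP; right.
  by apply: (card_fibers (Q := fun f x => n < B * ill_degree d s l g (seeded L (f, x)))) => f;
    apply: ill_degree_deviation.
have h3 : #|E3| * 10 <= #|randomness|.
  have -> : #|E3| = #|[pred r : randomness | ~~ fits (sample_labels L (r.1, r.2)) (seeded L r.1)]|.
    by apply: eq_card => -[].
  rewrite [#|randomness|]card_prod.
  by apply: (card_fibers (Q := fun a y => ~~ fits (sample_labels L (a, y)) (seeded L a))) => a;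
    apply: fits_deviation.
have arith a b c e k : k <= a + (b + c) -> a * 10 <= e -> b * 10 <= e -> c * 10 <= e ->
  k * 10 <= 3 * e by lia.
exact: arith le h1 h2 h3.
Qed.

End Deviations.
(** Both counts are within [n / w] of the same empirical estimate. *)
Lemma fits_close labs I J : fits labs I -> fits labs J ->
  forall c, w * label_count I c <= w * label_count J c + 2 * n.
Proof.
move=> /forallP fI /forallP fJ c; have /andP[i _] := fI c; have /andP[_ j] := fJ c.
rewrite -(leq_pmul2l t_gt0); move: i j.
by move: (label_count I c) (label_count J c) (count_mem _ _) w t => x y k w' t'; lia.
Qed.

Lemma output_prob_ge (L : 'I_n -> seq 'I_n) b : forest_lists L -> 0 < n ->
  (forall r, representative L r -> accepts (sample_labels L r) = b) ->
  (2%:R / 3%:R <= (\sum_(r : randomness) (accepts (sample_labels L r) == b)%:R) / #|randomness|%:R :> R)%R.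
Proof.
move=> FL n0 Hb; have un := card_unrepresentative FL n0.
have ge : #|[pred r | representative L r]| <= \sum_(r : randomness) (accepts (sample_labels L r) == b).
  rewrite card_sum_nat; apply: leq_sum => r _ /=.
  by case rr: (representative L r) => //; rewrite Hb ?eqxx.
have C := cardC [pred r | representative L r].
have C' : #|[predC [pred r | representative L r]]| = #|[pred r | ~~ representative L r]|.
  by apply: eq_card.
rewrite -natr_sum; move: un ge C; rewrite C'.
have r0 : 0 < #|randomness|.
  by apply/card_gt0P; exists ([ffun=> ord0], [ffun=> Ordinal (fact_gt0 n)], [ffun=> Ordinal n0]).
move: #|randomness| #|[pred r | ~~ _]| #|[pred r | representative L r]| (\sum_r _) r0.
move=> N u v x N0 un ge C.
have NR : (0 < N%:R :> R)%R by rewrite ltr0n.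
rewrite ler_pdivlMr // mulrAC ler_pdivrMr ?ltr0n // -!natrM ler_nat.
by lia.
Qed.

Variable eps : R.
Hypothesis eps_A : (10 < eps * A%:R)%R.

Lemma accepts_satisfying (G : graph n) (L : adj_list G) r :
  forest G -> P n G -> representative L r -> accepts (sample_labels L r).
Proof. by move=> FG PG /andP[gI fI]; apply/asboolP; exists G, L, r.1. Qed.

(** An accepting [H] would have a copy at distance at most [10 n / A], less than [eps * n], from
    [G]. *)
Lemma rejects_far (G : graph n) (L : adj_list G) r : 0 < n ->
  forest G -> eps_far eps P G -> representative L r -> ~~ accepts (sample_labels L r).
Proof.
move=> n0 FG far /andP[gI fI]; apply/asboolP => -[H [LH [a [PH FH gJ fJ]]]].
have FL := adj_list_forest L FG; have FLH := adj_list_forest LH FH.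
have cIJ : @close_counts d s l g m w 'I_n (seeded L r.1) (seeded LH a).
  by move=> c; rewrite [in X in _ <= _ + X]card_ord; apply: fits_close fI fJ c.
have cJI : @close_counts d s l g m w 'I_n (seeded LH a) (seeded L r.1).
  by move=> c; rewrite [in X in _ <= _ + X]card_ord; apply: fits_close fJ fI c.
have [f injf] :=
  @good_close A d s l g m w 'I_n m_gt0 g_def g_gt0 (erefl w) w_gt0 (seeded L r.1) (seeded LH a)
    FL FLH gI gJ cIJ cJI.
rewrite card_ord => close.
have := far (pullback H f) (pullback_satisfies injf PH).
have := edit_distance_le G (pullback H f).
set D := edit_distance _ _ => leD.
have {}leD : A * D <= 10 * n.
  apply: leq_trans close; rewrite leq_mul2l; apply/orP; right; apply: leq_trans leD _.
  by apply: leq_add; apply: subset_leq_card; apply/subsetP => -[x y]; rewrite !inE /= !mem_nbrs.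
move=> epsD; move: leD; rewrite -(ler_nat R) !natrM leNgt => /negP; apply.
have nR : (0 < n%:R :> R)%R by rewrite ltr0n.
have AR : (0 < A%:R :> R)%R by rewrite ltr0n.
apply: lt_le_trans (_ : (eps * A%:R * n%:R <= _)%R); first by rewrite ltr_pM2r.
by rewrite mulrAC mulrC ler_wpM2l // ltW.
Qed.

End Size.

(** Only the position of the leading bit of a degree has a range that grows with [n], so there are
    [O(log n)] labels, and [sample_size] is [40 * B ^ 2] times the cube of their number. *)
Lemma sample_size_le n : 1 < n -> sample_size n <=
  (40 * B ^ 2 * ((2 * (g.*2.+1 * m.+1 ^ #|T|) + 1) * #|T|) ^ 3) * trunc_log 2 n ^ 3.
Proof.
move=> n1; have l0 : 0 < trunc_log 2 n by rewrite trunc_log_gt0.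
rewrite /sample_size /tester_precision; set X := g.*2.+1 * m.+1 ^ #|T|.
pose lam := #|{: option (hub_class g m S (trunc_log 2 #|'I_n|)) * T}|; rewrite -/lam.
have lamE : lam <= (2 * X + 1) * #|T| * trunc_log 2 n.
  rewrite /lam card_prod card_option !card_prod card_ffun !card_ord [leqRHS]mulnAC leq_mul2r.
  apply/orP; right; rewrite -mulnA -/X; move: (X) (trunc_log 2 n) l0 => x y y0.
  by have := leq_mul (leqnn x) y0; lia.
have E b y : 10 * y * (2 * y * b) ^ 2 = 40 * b ^ 2 * y ^ 3 by rewrite !expnS !expn0; lia.
by rewrite E -[leqRHS]mulnA -expnMn leq_mul2l leq_exp2r // lamE orbT.
Qed.

End Tester.

Local Open Scope ring_scope.

Theorem theorem3 (R : realType) (P : graph_property) (eps : R)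
    (eps_gt0 : 0 < eps) (eps_lt1 : eps < 1) :
  exists (A : forall n : nat, algorithm n) (q : nat -> nat),
    polylog q /\
    forall (n : nat) (G : graph n) (L : adj_list G),
      (0 < n)%N -> forest G ->
      [/\ P n G -> 2%:R / 3%:R <= output_prob R L (A n) true,
          eps_far eps P G -> 2%:R / 3%:R <= output_prob R L (A n) false
        & (query_count L (A n) <= q n)%N].
Proof.
(* The distance [10 n / A] left by [good_close] has to be below [eps * n]. *)
pose A := (Num.bound (10 / eps)).+1.
have A_gt0 : (0 < A)%N by [].
have eps_A : (10 < eps * A%:R)%R.
  have := archi_boundP (divr_ge0 (ler0n R 10) (ltW eps_gt0)).
  rewrite ltr_pdivrMr // mulrC => lt; apply: lt_le_trans lt _.
  by rewrite ler_pM2l // ler_nat /A.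
move: A A_gt0 eps_A => A A_gt0 eps_A.
pose d := (48 * A)%N.-1; pose s := (24 * A)%N.-1; pose M := (160 * A)%N.-1.
have dE : d.+1 = (48 * A)%N by rewrite /d prednK // muln_gt0.
have sE : s.+1 = (24 * A)%N by rewrite /s prednK // muln_gt0.
have ME : M.+1 = (160 * A)%N by rewrite /M prednK // muln_gt0.
move: d s M dE sE ME => d s M dE sE ME.
pose S := (d.+1 ^ (s.*2 + M * M))%N; pose B := (2 * S * d * A)%N.
pose g := (8 * #|piece_type S| * B)%N; pose m := (20 * B * #|piece_type S| * g ^ 2)%N.
have gE : g = (8 * #|piece_type (d.+1 ^ (s.*2 + M * M))| * (2 * d.+1 ^ (s.*2 + M * M) * d * A))%N by [].
have mE : m = (20 * (2 * d.+1 ^ (s.*2 + M * M) * d * A) *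
  #|piece_type (d.+1 ^ (s.*2 + M * M))| * g ^ 2)%N by [].
move: g m gE mE => g m gE mE {S B}.
have alg n : {Alg : algorithm n | (0 < n)%N -> forall L,
    (forall b, output_prob R L Alg b = ((\sum_(r : randomness A d s M g m n)
       (accepts P A (sample_labels L r) == b)%:R) / #|randomness A d s M g m n|%:R)%R) /\
    (query_count L Alg <= sample_size A d s M g m n * label_cost d s (M * M) m)%N}.
  (* No vertex can be drawn when [n = 0], so there is no seed and a dummy algorithm is used. *)
  case: (posnP n) => [n0|n0]; first by exists (Output n true); rewrite n0.
  by have [Alg H] := tester_algorithm R P A d s M g m n0; exists Alg.
exists (fun n => sval (alg n)), 
  (fun n => sample_size A d s M g m n * label_cost d s (M * M) m)%N.
split.
  (* The exponent is that of [sample_size_le]; the cost of a label goes into the constant. *)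
  eexists _, 3 => n n1.
  apply: leq_trans (leq_mul (sample_size_le A_gt0 dE sE ME gE mE n1) (leqnn _)) _.
  by rewrite mulnAC.
move=> n G L n0 FG; have [probE cost] := svalP (alg n) n0 L.
have FL := adj_list_forest L FG.
split=> [PG|far|//]; rewrite probE.
  by apply: (@output_prob_ge R P A d s M g m A_gt0 dE sE ME gE mE n L true FL n0) => r; apply: accepts_satisfying.
apply: (@output_prob_ge R P A d s M g m A_gt0 dE sE ME gE mE n L false FL n0) => r rr; apply/negbTE.
exact: (rejects_far A_gt0 dE sE ME gE mE eps_A n0 FG far rr).
Qed.
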